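(* Let $\mathcal{H}$ be a real Hilbert space, $A:\mathcal{H}\rightrightarrows\mathcal{H}$ a maximally monotone operator and $C:\mathcal{H}\to\mathcal{H}$ a monotone and $\nu$-Lipschitz continuous operator with $\nu>0$. Let $m\ge1$ be an integer and for $i=1,\dots,m$ let $\mathcal{G}_i$ be a real Hilbert space, $B_i:\mathcal{G}_i\rightrightarrows\mathcal{G}_i$ a maximally monotone operator, $D_i:\mathcal{G}_i\rightrightarrows\mathcal{G}_i$ a monotone operator such that $D_i^{-1}$ is (single-valued on $\mathcal{G}_i$ and) $\nu_i$-Lipschitz continuous with $\nu_i>0$, and $L_i:\mathcal{H}\to\mathcal{G}_i$ a nonzero linear continuous operator. Let $B:\mathcal{H}\to\mathcal{H}$ be monotone and $\mu^{-1}$-Lipschitz continuous with $\mu>0$ and suppose $M:=\operatorname{zer}B\ne\emptyset$. Let $(\lambda_n)_{n\ge1}$, $(\beta_n)_{n\ge1}$, $(\alpha_n)_{n\ge1}$ be sequences of positive real numbers. Let $(x_0,v_{1,0},\dots,v_{m,0}),(x_1,v_{1,1},\dots,v_{m,1})\in\mathcal{H}\times\mathcal{G}_1\times\dots\times\mathcal{G}_m$ and, for every $n\ge1$, set $$p_n=J_{\lambda_nA}\Big[x_n-\lambda_n\Big(Cx_n+\sum_{i=1}^mL_i^*v_{i,n}\Big)-\lambda_n\beta_nBx_n+\alpha_n(x_n-x_{n-1})\Big],$$ $$q_{i,n}=J_{\lambda_nB_i^{-1}}\big[v_{i,n}+\lambda_n(L_ix_n-D_i^{-1}v_{i,n})+\alpha_n(v_{i,n}-v_{i,n-1})\big],\quad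 i=1,\dots,m,$$ $$x_{n+1}=\lambda_n\beta_n(Bx_n-Bp_n)+\lambda_n(Cx_n-Cp_n)+\lambda_n\sum_{i=1}^mL_i^*(v_{i,n}-q_{i,n})+p_n,$$ $$v_{i,n+1}=\lambda_nL_i(p_n-x_n)+\lambda_n(D_i^{-1}v_{i,n}-D_i^{-1}q_{i,n})+q_{i,n},\quad i=1,\dots,m,$$ and let $z_n=\frac1{\tau_n}\sum_{k=1}^n\lambda_kx_k$ with $\tau_n=\sum_{k=1}^n\lambda_k$. Put $$\mathcal{Z}:=\operatorname{zer}\Big(A+\sum_{i=1}^mL_i^*\circ(B_i\Box D_i)\circ L_i+C+N_M\Big),\qquad \beta:=\max\{\nu,\nu_1,\dots,\nu_m\}+\sqrt{\sum_{i=1}^m\|L_i\|^2}.$$ Assume that: (1) $A+N_M$ is maximally monotone and $\mathcal{Z}\ne\emptyset$; (2) for every $p\in\operatorname{ran}N_M$, $$\sum_{n\ge1}\lambda_n\beta_n\left[\sup_{y\in M}\varphi_B\left(y,\frac{p}{\beta_n}\right)-\sigma_M\left(\frac{p}{\beta_n}\right)\right]<+\infty;$$ (3) $(\lambda_n)_{n\ge1}\in\ell^2\setminus\ell^1$; (4) $(\alpha_n)_{n\ge1}$ is nondecreasing and there exist $n_0\ge1$, $\alpha\ge0$ and $\sigma>0$ such that for all $n\ge n_0$ $$0\le\alpha_n\le\alpha\quad\text{and}\quad 5\alpha+2\sigma+(1+4\alpha+2\sigma)\left(\frac{\lambda_n\beta_n}{\mu}+\lambda_n\beta\right)^2\le1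 .$$ Then $(z_n)_{n\ge1}$ converges weakly to an element of $\mathcal{Z}$ as $n\to+\infty$. If, additionally, $A$ and $B_i^{-1}$, $i=1,\dots,m$, are strongly monotone, then $(x_n)_{n\ge1}$ converges strongly to the unique element of $\mathcal{Z}$ as $n\to+\infty$.
   Context: For a set-valued operator $T:\mathcal{H}\rightrightarrows\mathcal{H}$ on a real Hilbert space: $\operatorname{Gr}T=\{(x,u):u\in Tx\}$, $\operatorname{zer}T=\{x:0\in Tx\}$, $\operatorname{ran}T=\{u:\exists x,\ u\in Tx\}$, and $T^{-1}$ is the set-valued inverse, $(u,x)\in\operatorname{Gr}T^{-1}$ iff $(x,u)\in\operatorname{Gr}T$. $T$ is monotone if $\langle x-y,u-v\rangle\ge0$ for all $(x,u),(y,v)\in\operatorname{Gr}T$; maximally monotone if it is monotone and its graph has no proper monotone extension; strongly monotone if for some $\gamma>0$, $\langle x-y,u-v\rangle\ge\gamma\|x-y\|^2$ for all $(x,u),(y,v)\in\operatorname{Gr}T$. The resolvent of $T$ is $J_T=(\mathrm{Id}+T)^{-1}$ (single-valued and everywhere defined when $T$ is maximally monotone). The parallel sum of $T_1,T_2$ is $T_1\Box T_2=(T_1^{-1}+T_2^{-1})^{-1}$. $L_i^*$ denotes the adjoint of $L_i$ and $\|L_i\|$ its operator norm. For a nonempty convex set $M\subseteq\mathcal{H}$: the normal cone is $N_M(x)=\{u:\langle u,y-x\rangle\le0\ \forall y\in M\}$ if $x\in M$ and $N_M(x)=\emptyset$ if $x\notin M$; the support function is $\sigma_M(u)=\sup_{y\in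 M}\langle y,u\rangle$. The Fitzpatrick function of a monotone operator $T$ is $\varphi_T:\mathcal{H}\times\mathcal{H}\to\overline{\mathbb{R}}$, $\varphi_T(x,u)=\sup_{(y,v)\in\operatorname{Gr}T}\{\langle x,v\rangle+\langle y,u\rangle-\langle y,v\rangle\}$. *)

(* Defs.v *)
From HB Require Import structures.
From mathcomp Require Import all_boot all_order all_algebra.
From mathcomp Require Import all_classical all_reals all_analysis.

Set Implicit Arguments.
Unset Strict Implicit.
Unset Printing Implicit Defensive.

Import Order.TTheory GRing.Theory Num.Theory.
Import numFieldNormedType.Exports.

Local Open Scope classical_set_scope.
Local Open Scope ring_scope.

(* A real Hilbert space is a complete normed module whose norm is induced by an
   inner product; positive definiteness of [inner] follows from [inner_sqr]. *)
HB.mixin Record NormedModule_hasInner (R : realType) H of NormedModule R H := {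
  inner : H -> H -> R ;
  innerC : forall x y, inner x y = inner y x ;
  inner_linearl : forall (a : R) x y z,
    inner (a *: x + y) z = a * inner x z + inner y z ;
  inner_sqr : forall x, inner x x = `|x| ^+ 2
}.

#[short(type="hilbertType")]
HB.structure Definition Hilbert (R : realType) :=
  {H of NormedModule_hasInner R H & CompleteNormedModule R H}.

Section LinearMaps.
Context {R : realType} {H G : hilbertType R}.

Definition opnorm (L : H -> G) : R := sup [set `|L x| | x in [set x | `|x| <= 1]].

(* For continuous linear [L] and every [y], the set below is a singleton by the
   Riesz representation theorem, so the default value 0 is never used. *)
Definition adjoint (L : H -> G) (y : G) : H :=
  xget 0 [set z | forall x, inner (L x) y = inner x z].

End LinearMaps.

(* A set-valued operator H ⇉ H is a map [T : H -> set H]; [T x u] means u ∈ Tx. *)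
Section Operators.
Context {R : realType} {H : hilbertType R}.
Implicit Types (T S : H -> set H) (M : set H).

Definition graph T : set (H * H) := [set xu | T xu.1 xu.2].

Definition zer T : set H := [set x | T x 0].

Definition ran T : set H := [set u | exists x, T x u].

Definition op_inv T : H -> set H := fun u => [set x | T x u].

(* A single-valued operator seen as a set-valued one. *)
Definition op_fun (f : H -> H) : H -> set H := fun x => [set f x].

Definition op_add T S : H -> set H := fun x => [set u + v | u in T x & v in S x].

Definition op_scale (a : R) T : H -> set H := fun x => [set a *: u | u in T x].

Definition op_sum (m : nat) (T : 'I_m -> H -> set H) : H -> set H :=
  fun x => [set \sum_(i < m) w i | w in [set w : 'I_m -> H | forall i, T i x (w i)]].

Definition parallel_sum T S : H -> set H := op_inv (op_add (op_inv T) (op_inv S)).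

Definition resolvent T : H -> set H := op_inv (op_add (op_fun id) T).

Definition monotone_op T :=
  forall x y u v, T x u -> T y v -> 0 <= inner (x - y) (u - v).

Definition maximally_monotone T :=
  monotone_op T /\
  forall S, monotone_op S -> graph T `<=` graph S -> graph S = graph T.

Definition strongly_monotone T :=
  exists2 c : R, 0 < c &
    forall x y u v, T x u -> T y v -> c * `|x - y| ^+ 2 <= inner (x - y) (u - v).

Definition normal_cone M : H -> set H :=
  fun x => [set u | M x /\ forall y, M y -> inner u (y - x) <= 0].

Definition support_fun M (u : H) : \bar R :=
  ereal_sup [set (inner y u)%:E | y in M].

Definition fitzpatrick T (x u : H) : \bar R :=
  ereal_sup [set (inner x yv.2 + inner yv.1 u - inner yv.1 yv.2)%:E
            | yv in graph T].

Definition weak_cvg (z : nat -> H) (l : H) :=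
  forall y, inner (z n) y @[n --> \oo] --> inner l y.

(* Sequences are indexed from 1 in the two definitions below: the value at 0 of
   [lambda], [u] is ignored. *)
Definition ergodic_mean (lambda : nat -> R) (x : nat -> H) (n : nat) : H :=
  (\sum_(1 <= k < n.+1) lambda k)^-1 *: \sum_(1 <= k < n.+1) lambda k *: x k.

End Operators.

Definition in_ell {R : realType} (p : nat) (u : nat -> R) :=
  (\sum_(1 <= n <oo) (`|u n| ^+ p)%:E < +oo)%E.

(* L^* ∘ T ∘ L for a set-valued T. *)
Definition op_conj {R : realType} {H G : hilbertType R}
    (L : H -> G) (T : G -> set G) : H -> set H :=
  fun x => adjoint L @` T (L x).

(* Main.v *)
Require Import Defs.
From HB Require Import structures.
From mathcomp Require Import all_boot all_order all_algebra.
From mathcomp Require Import all_classical all_reals all_analysis.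
From mathcomp Require Import ring lra.

Set Implicit Arguments.
Unset Strict Implicit.
Unset Printing Implicit Defensive.

Import Order.TTheory GRing.Theory Num.Theory.
Import numFieldNormedType.Exports.

Local Open Scope classical_set_scope.
Local Open Scope ring_scope.

(* In the product space H x G_1 x ... x G_m the algorithm is an inertial
   forward-backward-forward iteration X_n = (x_n, v_n) for the sum of
   (A + N_M) x B_1^-1 x ... x B_m^-1 and a monotone Lipschitz operator, with the
   penalty lambda_n beta_n B.  For (u, w) in the graph of that sum, the squared
   distances |X_n - u|^2 satisfy an inertial quasi-Fejer inequality whose errors
   are 2 lambda_n <u - X_n, w> and summable terms: Fitzpatrick's function bounds the
   penalty, and lambda in l^2 bounds lambda_n^2 |w|^2.
   For w = 0 the distances converge; for general w, dividing by tau_n and letting n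
   tend to infinity puts every weak cluster point of the means in the zero set, by
   maximality.  An Opial argument leaves only one cluster point.
   Weak cluster points are limits along ultrafilters, which exist by the Riesz
   theorem.  Maximality of the sum rests on Minty's theorem and a Banach fixed
   point.  Both Riesz's and Minty's theorems are instances of one convex
   minimization principle, [convex_min]. *)

(** * Inner products and convex minimization *)

Section Inner.
Context {R : realType} {H : hilbertType R}.
Implicit Types (x y z : H) (a : R).

Lemma innerDl x y z : inner (x + y) z = inner x z + inner y z.
Proof. by rewrite -[x in LHS]scale1r inner_linearl mul1r. Qed.

Lemma inner0l z : inner 0 z = 0.
Proof. by apply: (addrI (inner 0 z)); rewrite -innerDl !addr0. Qed.

Lemma innerZl a x z : inner (a *: x) z = a * inner x z.
Proof. by rewrite -[a *: x]addr0 inner_linearl inner0l addr0. Qed.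

Lemma innerNl x z : inner (- x) z = - inner x z.
Proof. by rewrite -scaleN1r innerZl mulN1r. Qed.

Lemma innerBl x y z : inner (x - y) z = inner x z - inner y z.
Proof. by rewrite innerDl innerNl. Qed.

Lemma innerDr x y z : inner z (x + y) = inner z x + inner z y.
Proof. by rewrite innerC innerDl !(innerC z). Qed.

Lemma inner0r z : inner z 0 = 0.
Proof. by rewrite innerC inner0l. Qed.

Lemma innerZr a x z : inner z (a *: x) = a * inner z x.
Proof. by rewrite innerC innerZl (innerC z). Qed.

Lemma innerNr x z : inner z (- x) = - inner z x.
Proof. by rewrite innerC innerNl (innerC z). Qed.

Lemma innerBr x y z : inner z (x - y) = inner z x - inner z y.
Proof. by rewrite innerDr innerNr. Qed.

Definition innerE := (innerDl, innerDr, innerNl, innerNr, innerZl, innerZr).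

Lemma inner_suml (I : Type) (r : seq I) (P : pred I) (F : I -> H) z :
  inner (\sum_(i <- r | P i) F i) z = \sum_(i <- r | P i) inner (F i) z.
Proof.
elim/big_rec2: _ => [|i a x _ <-]; first exact: inner0l.
by rewrite innerDl.
Qed.

Lemma inner_sumr (I : Type) (r : seq I) (P : pred I) (F : I -> H) z :
  inner z (\sum_(i <- r | P i) F i) = \sum_(i <- r | P i) inner z (F i).
Proof. by rewrite innerC inner_suml; apply: eq_bigr => i _; exact: innerC. Qed.

Lemma normB_sqr x y : `|x - y| ^+ 2 = `|x| ^+ 2 - 2 * inner x y + `|y| ^+ 2.
Proof. by rewrite -!inner_sqr !innerE (innerC y x); ring. Qed.

(** The squared norm of [|y| x - |x| y] expands to [2 |x| |y| (|x| |y| - inner x y)]. *)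
Lemma inner_le x y : inner x y <= `|x| * `|y|.
Proof.
have [->|x0] := eqVneq x 0; first by rewrite inner0l normr0 mul0r.
have [->|y0] := eqVneq y 0; first by rewrite inner0r normr0 mulr0.
have := sqr_ge0 `| `|y| *: x - `|x| *: y |.
rewrite -inner_sqr !innerE (innerC y x) !inner_sqr => h.
have {}h : 0 <= 2 * (`|x| * `|y|) * (`|x| * `|y| - inner x y).
  by apply: le_trans h _; rewrite le_eqVlt; apply/orP; left; apply/eqP; ring.
have c0 : 0 < 2 * (`|x| * `|y|) by rewrite !mulr_gt0 // normr_gt0.
by rewrite pmulr_rge0 // subr_ge0 in h.
Qed.

Lemma normr_inner_le x y : `|inner x y| <= `|x| * `|y|.
Proof.
by rewrite ler_norml inner_le andbT lerNl -innerNl (le_trans (inner_le _ _)) // normrN.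
Qed.

Lemma inner_inj x y : (forall z, inner x z = inner y z) -> x = y.
Proof.
move=> h; apply/eqP; rewrite -subr_eq0 -normr_eq0 -sqrf_eq0 -inner_sqr.
by rewrite innerBl h subrr.
Qed.

Lemma cvg_innerl (T : Type) (F : set_system T) {FF : Filter F} (f : T -> H) x z :
  f @ F --> x -> inner (f t) z @[t --> F] --> inner x z.
Proof.
move=> fx; apply/cvgrPdist_le => e e0.
have d0 : 0 < `|z| + 1 by rewrite ltr_wpDl.
near=> t.
rewrite -innerBl (le_trans (normr_inner_le _ _))//.
have : `|x - f t| <= e / (`|z| + 1).
  near: t; move/cvgrPdist_le : fx; apply; exact: divr_gt0.
rewrite ler_pdivlMr // => h; apply: le_trans h; rewrite ler_wpM2l // lerDl //.
Unshelve. all: by end_near. Qed.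

End Inner.

Lemma normD_sqr_le {R : realType} {H : hilbertType R} (x y : H) :
  `|x + y| ^+ 2 <= 2 * `|x| ^+ 2 + 2 * `|y| ^+ 2.
Proof.
have := sqr_ge0 `|x - y|; rewrite -!inner_sqr !innerE (innerC y x); lra.
Qed.

(** A first-order test: divide by [s] and let it tend to 0. If [x > 0], then [s = 1] forces [y > 0],
    and any [s] at most [x / (2 y)] yields [x <= x / 2]. *)
Lemma ler_eps_mul {R : realType} (x y : R) :
  (forall s, 0 < s -> s <= 1 -> s * x <= s ^+ 2 * y) -> x <= 0.
Proof.
move=> h; rewrite leNgt; apply/negP => x0.
have y0 : 0 < y by have := h 1 ltr01 (lexx _); lra.
pose s := Num.min 1 (x / (2 * y)).
have xy0 : 0 < x / (2 * y) by rewrite divr_gt0 // mulr_gt0.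
have s0 : 0 < s by rewrite lt_min ltr01 xy0.
have s1 : s <= 1 by rewrite ge_min lexx.
have := h _ s0 s1; rewrite expr2 -mulrA ler_pM2l // leNgt => /negP; apply.
have : s <= x / (2 * y) by rewrite ge_min lexx orbT.
rewrite ler_pdivlMr ?mulr_gt0 //; lra.
Qed.

(* Only convexity of [S] enters: along a minimizing sequence of [|e|^2 + c] the
   points [e] are Cauchy by the parallelogram identity, and the conclusion is the
   first-order optimality condition at their limit. *)
Lemma convex_min {R : realType} {H : hilbertType R} (S : H -> R -> Prop) (b : R) :
  (exists e c, S e c) ->
  (forall s e c e' c', 0 <= s -> s <= 1 -> S e c -> S e' c' ->
     S ((1 - s) *: e + s *: e') ((1 - s) * c + s * c')) ->
  (forall e c, S e c -> b <= `|e| ^+ 2 + c) ->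
  exists x, forall e c, S e c -> b <= c + 2 * inner x e - `|x| ^+ 2.
Proof.
move=> [e0 [c0 S0]] conv lb.
pose J := [set r | exists e c, S e c /\ r = `|e| ^+ 2 + c].
have Jinf : has_inf J.
  split; first by exists (`|e0| ^+ 2 + c0), e0, c0.
  by exists b => _ [e [c [/lb ? ->]]].
have bI : b <= inf J.
  apply: lb_le_inf; first by case: Jinf.
  by move=> _ [e [c [/lb ? ->]]].
have IJ e c : S e c -> inf J <= `|e| ^+ 2 + c.
  by move=> Sec; apply: ge_inf; [case: Jinf|exists e, c].
have /choice[d /choice[c Sdc]] : forall n, exists d c, S d c /\ `|d| ^+ 2 + c < inf J + n.+1%:R^-1.
  move=> n; have n0 : 0 < n.+1%:R^-1 :> R by rewrite invr_gt0.
  by have [_ [e [c [Se ->]] ?]] := inf_adherent n0 Jinf; exists e, c.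
(* The value at the midpoint is at least [inf J]; the parallelogram identity turns this into a bound
   on the distance. *)
have dC n k : `|d n - d k| ^+ 2 <= 2 * (n.+1%:R^-1 + k.+1%:R^-1).
  have [Sn ltn] := Sdc n; have [Sk ltk] := Sdc k.
  have h2 : 0 <= 2^-1 :> R by lra.
  have h2' : 2^-1 <= 1 :> R by lra.
  have := IJ _ _ (conv _ _ _ _ _ h2 h2' Sn Sk).
  rewrite normB_sqr; move: ltn ltk; rewrite -!inner_sqr !innerE (innerC (d k) (d n)).
  move: (inner _ _) (inner (d n) (d n)) (inner (d k) (d k)) (n.+1%:R^-1) (k.+1%:R^-1) (inf J). move=> *; lra.
have dcv : cvgn d.
  apply: cauchy_cvg; apply/cauchy_exP => e e0'.
  have e20 : 0 < e ^+ 2 / 8 by rewrite divr_gt0 // exprn_gt0.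
  have [N _ hN] := near_infty_natSinv_lt (PosNum e20).
  exists (d N); exists N => // n Nn.
  rewrite -ball_normE /ball_ /= -(@ltr_pXn2r _ 2) ?nnegrE // ?ltW //.
  have := hN _ (leqnn N); have := hN _ Nn; have := dC N n => /=.
  have : 0 < e ^+ 2 by rewrite exprn_gt0.
  by move: (`|_| ^+ 2) (N.+1%:R^-1) (n.+1%:R^-1) (e ^+ 2) => *; lra.
pose x := limn d; have dx : d n @[n --> \oo] --> x by exact: dcv.
exists x => e ce Se.
apply: (le_trans bI); rewrite -subr_ge0 -oppr_le0.
(* Optimality along the segment from the minimizing points towards [e]; once [n] tends to infinity,
   only terms of order [s] and [s ^ 2] remain. *)
apply: (@ler_eps_mul _ _ (`|e - x| ^+ 2)) => s s0 s1.
have hn n : s * (inf J - ce - 2 * inner (d n) e + `|d n| ^+ 2)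
    <= n.+1%:R^-1 + s ^+ 2 * `|e - d n| ^+ 2.
  have [Sn ltn] := Sdc n.
  have := IJ _ _ (conv _ _ _ _ _ (ltW s0) s1 Sn Se).
  have : (1 - s) * c n <= (1 - s) * (inf J + n.+1%:R^-1 - `|d n| ^+ 2).
    by rewrite ler_wpM2l ?subr_ge0 // lerBrDl ltW.
  have : 0 <= s * n.+1%:R^-1 by rewrite mulr_ge0 // ltW.
  rewrite normB_sqr -!inner_sqr !innerE (innerC e (d n)).
  move: (inner _ _) (inner (d n) (d n)) (inner e e) (n.+1%:R^-1) (inf J) (c n) => *.
  nra.
have cl : (s * (inf J - ce - 2 * inner (d n) e + `|d n| ^+ 2)) @[n --> \oo]
    --> s * (inf J - ce - 2 * inner x e + `|x| ^+ 2).
  apply: cvgMr; apply: cvgD.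
    apply: cvgB; first exact: cvg_cst.
    by apply: cvgMr; exact: cvg_innerl.
  by rewrite !expr2; under eq_fun do rewrite expr2; apply: cvgM; exact: cvg_norm.
have cr : (n.+1%:R^-1 + s ^+ 2 * `|e - d n| ^+ 2) @[n --> \oo]
    --> 0 + s ^+ 2 * `|e - x| ^+ 2.
  apply: cvgD; first exact: cvg_harmonic.
  apply: cvgMr; rewrite !expr2; under eq_fun do rewrite expr2.
  by apply: cvgM; apply: cvg_norm; apply: cvgB => //; exact: cvg_cst.
rewrite add0r in cr.
have : s * (inf J - ce - 2 * inner x e + `|x| ^+ 2) <= s ^+ 2 * `|e - x| ^+ 2.
  by apply: ler_cvg_to cl cr _; exact: nearW.
by apply: le_trans; rewrite le_eqVlt; apply/orP; left; apply/eqP; ring.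
Unshelve. all: by end_near. Qed.

(** * Adjoints and Minty's theorem *)

Section Riesz.
Context {R : realType} {H : hilbertType R}.

(** The minimizer of [|e|^2 - 2 f e], which is bounded below by [- K^2], represents [f]. Indeed
    [convex_min] leaves [f e - inner e z] bounded above in [e], and a linear functional bounded
    above vanishes. *)
Lemma riesz (f : H -> R) (K : R) :
  (forall a x y, f (a *: x + y) = a * f x + f y) ->
  (forall x, f x <= K * `|x|) -> exists z, forall x, f x = inner x z.
Proof.
move=> flin fK.
have f0 : f 0 = 0.
  by have := flin 1 0 0; rewrite scaler0 addr0 mul1r; lra.
have fZ a x : f (a *: x) = a * f x by rewrite -[a *: x]addr0 flin f0 addr0.
have [||e c -> |z hz] := @convex_min _ _ (fun e c => c = - 2 * f e) (- K ^+ 2).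
- by exists 0, (- 2 * f 0).
- move=> s e c e' c' _ _ -> ->; rewrite flin fZ; ring.
- have := fK e; have := sqr_ge0 (`|e| - K); rewrite sqrrB; lra.
have {}hz e : f e - inner e z <= 0.
  rewrite leNgt; apply/negP => g0.
  have := hz ((K ^+ 2 / (f e - inner e z) + 1) *: e) _ erefl.
  rewrite fZ innerZr (innerC z).
  have := sqr_ge0 K; have := sqr_ge0 `|z|.
  have : K ^+ 2 / (f e - inner e z) * (f e - inner e z) = K ^+ 2.
    by rewrite divfK ?gt_eqF.
  move: (K ^+ 2 / _) => t; nra.
exists z => x; apply/eqP; rewrite eq_le -subr_le0 hz /=.
by rewrite -subr_le0 -opprB oppr_le0 -oppr_le0 opprB;
  have := hz (- 1 *: x); rewrite fZ innerZl; lra.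
Qed.

End Riesz.

Section Adjoint.
Context {R : realType} {H G : hilbertType R}.
Variable L : {linear H -> G}.
Hypothesis Lc : continuous L.

Lemma opnorm_has_sup : has_sup [set `|L x| | x in [set x : H | `|x| <= 1]].
Proof.
split; first by exists `|L 0|, 0 => //=; rewrite normr0.
have /linear_boundedP/pinfty_ex_gt0[k k0 hk] : bounded_near L (nbhs 0).
  by apply: continuous_linear_bounded; exact: Lc.
exists k => _ [x /= x1 <-]; apply: le_trans (hk _) _.
by rewrite -[leRHS]mulr1 ler_wpM2l // ltW.
Qed.

Lemma opnorm_ge0 : 0 <= opnorm L.
Proof.
apply: le_trans (normr_ge0 (L 0)) _.
by apply: (ub_le_sup (proj2 opnorm_has_sup)); exists 0 => //=; rewrite normr0.
Qed.

Lemma opnormP x : `|L x| <= opnorm L * `|x|.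
Proof.
have [->|x0] := eqVneq x 0; first by rewrite linear0 !normr0 mulr0.
have nx0 : 0 < `|x| by rewrite normr_gt0.
rewrite -ler_pdivrMr // mulrC -[X in X * _](ger0_norm (_ : 0 <= `|x|^-1)) ?invr_ge0 //.
rewrite -normrZ -linearZ.
apply: (ub_le_sup (proj2 opnorm_has_sup)); eexists; last reflexivity.
by rewrite /= normrZ normfV normr_id mulVf // gt_eqF.
Qed.

Lemma adjointP x y : inner (L x) y = inner x (adjoint L y).
Proof.
rewrite /adjoint; case: xgetP => [z -> /= h|hn]; first exact: h.
have [|x'|z hz] := @riesz _ _ (fun x => inner (L x) y) (opnorm L * `|y|).
- by move=> a u w /=; rewrite linearP innerDl innerZl.
- apply: le_trans (inner_le _ _) _.
  by rewrite mulrAC ler_wpM2r // opnormP.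
by exfalso; apply: (hn z).
Qed.

(** The adjoint identity at [x = adjoint L y] makes the square of [|adjoint L y|] an inner product
    with [y], to which Cauchy-Schwarz applies. *)
Lemma adjoint_le y : `|adjoint L y| <= opnorm L * `|y|.
Proof.
have [->|n0] := eqVneq (adjoint L y) 0.
  by rewrite normr0 mulr_ge0 // opnorm_ge0.
have p0 : 0 < `|adjoint L y| by rewrite normr_gt0.
rewrite -(ler_pM2l p0) -expr2 -inner_sqr -adjointP.
apply: le_trans (inner_le _ _) _.
by rewrite mulrA ler_wpM2r // mulrC opnormP.
Qed.

Lemma adjointB y z : adjoint L (y - z) = adjoint L y - adjoint L z.
Proof.
by apply: inner_inj => x; rewrite innerBl !(innerC _ x) -!adjointP innerBr.
Qed.

End Adjoint.

Section MaximalMonotone.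
Context {R : realType} {H : hilbertType R}.
Implicit Types T : H -> set H.

Definition monotonically_closed T :=
  forall x u, (forall y v, T y v -> 0 <= inner (x - y) (u - v)) -> T x u.

(** Adjoining [(x, u)] keeps the graph monotone, so by maximality the pair was already there. *)
Lemma maximally_monotone_closed T : maximally_monotone T -> monotonically_closed T.
Proof.
move=> [Tm Tx] x u h.
pose S y : set H := [set v | T y v \/ (y = x /\ v = u)].
have Sm : monotone_op S.
  move=> a b c d [Tac|[-> ->]] [Tbd|[-> ->]].
  - exact: Tm.
  - by rewrite -opprB -(opprB u) innerNl innerNr opprK; exact: h.
  - exact: h.
  - by rewrite subrr inner0l.
have /(Tx S Sm) gE : graph T `<=` graph S by move=> [a b] /= ?; left.
by have : graph S (x, u) by [right]; rewrite gE.
Qed.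

(* The convex set is the epigraph of the Fitzpatrick function of [T], which
   dominates the duality product because [T] is maximal. *)
Lemma minty0 T : monotone_op T -> monotonically_closed T -> exists x, T x (- x).
Proof.
move=> Tm Tc.
have [a0 [b0 T0]] : exists a b, T a b.
  apply: contrapT => h; apply: (h); exists 0, 0; apply: Tc => y v Tyv.
  by exfalso; apply: h; exists y, v.
(* The bound [c] dominates the Fitzpatrick function at [(y, v)]; of the pair itself only the half
   difference is kept as a point of [H]. *)
pose S e c := exists y v : H, e = 2^-1 *: (y - v) /\
  forall a b, T a b -> inner a v + inner y b - inner a b <= c.
have TS a b : T a b -> S (2^-1 *: (a - b)) (inner a b).
  move=> Tab; exists a, b; split=> // c d Tcd.
  have := Tm _ _ _ _ Tab Tcd; rewrite !innerE; lra.
have [||e c [y [v [-> h]]]|x hx] := @convex_min _ _ S 0.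
- by exists (2^-1 *: (a0 - b0)), (inner a0 b0); exact: TS.
- move=> s _ c _ c' s0 s1 [y [v [-> h]]] [y' [v' [-> h']]].
  exists ((1 - s) *: y + s *: y'), ((1 - s) *: v + s *: v'); split.
    rewrite !scalerA ![_ * 2^-1]mulrC -!scalerA -scalerDr; congr (_ *: _).
    by rewrite !scalerBr opprD addrACA.
  move=> a b Tab; rewrite !innerE.
  have := ler_wpM2l s0 (h' _ _ Tab).
  have s1' : 0 <= 1 - s by rewrite subr_ge0.
  have := ler_wpM2l s1' (h _ _ Tab).
  lra.
(* If [c < inner y v], then [(y, v)] is monotonically related to the graph, hence in it, and testing
   it against itself is contradictory. So [|e|^2 + c] is at least [|y + v|^2 / 4]. *)
- have yv : inner y v <= c.
    rewrite leNgt; apply/negP => lt.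
    have /h : T y v by apply: Tc => a b /h; rewrite !innerE; lra.
    lra.
  have := sqr_ge0 `|y + v|; rewrite -!inner_sqr !innerE (innerC v y); lra.
(* At a graph point [(a, b)] the bound obtained reads [0 <= inner (x - a) (- x - b)]. *)
exists x; apply: Tc => a b /TS/hx.
by rewrite -inner_sqr !innerE (innerC a x); lra.
Qed.

(** This is [minty0] for the shifted and rescaled operator [k^-1 (T - z)], which inherits both
    properties of [T]. *)
Lemma minty T (k : R) (z : H) : monotone_op T -> monotonically_closed T -> 0 < k ->
  exists x, T x (z - k *: x).
Proof.
move=> Tm Tc k0.
have [||x] := @minty0 (fun x w => T x (z + k *: w)).
- move=> x y u v Tu Tv; have := Tm _ _ _ _ Tu Tv.
  by rewrite opprD addrACA subrr add0r -scalerBr innerZr pmulr_rge0.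
- move=> x u h; apply: Tc => y v Tyv.
  have := h y (k^-1 *: (v - z)).
  rewrite scalerA divff ?gt_eqF // scale1r addrCA subrr addr0 => /(_ Tyv).
  rewrite -(pmulr_rge0 _ k0) -innerZr scalerBr scalerA divff ?gt_eqF // scale1r.
  by rewrite opprB addrA [k *: u + z]addrC.
by rewrite scalerN; exists x.
Qed.

(** A substitute for Minty's theorem for [T + C]. With [J] the resolvent of [k^-1 T], the point [u]
    is the fixed point of [u |-> J (z + k^-1 (b - C u))]; the choice [k = 2 nu + 1] makes this map a
    contraction of factor 1/2. *)
Lemma maximal_lipschitz_surj T (C : H -> H) (nu : R) :
  monotone_op T -> monotonically_closed T -> 0 <= nu ->
  (forall x y, `|C x - C y| <= nu * `|x - y|) ->
  exists2 k, 0 < k & forall z b, exists u s, T u s /\ s + C u - b = k *: (z - u).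
Proof.
move=> Tm Tc nu0 Cl; pose k : R := 2 * nu + 1.
have k0 : 0 < k by rewrite /k; lra.
exists k => // z b.
have /choice[J hJ] : forall w, exists u, T u (k *: w - k *: u).
  by move=> w; exact: minty.
have Jn u w : `|J u - J w| <= `|u - w|.
  have h : `|J u - J w| ^+ 2 <= inner (J u - J w) (u - w).
    rewrite -(ler_pM2l k0) -inner_sqr.
    by have := Tm _ _ _ _ (hJ u) (hJ w); rewrite !innerE; lra.
  have [->|n0] := eqVneq (J u - J w) 0; first by rewrite normr0.
  rewrite -(@ler_pM2l _ `|J u - J w|) ?normr_gt0 // -expr2.
  apply: le_trans h _; exact: inner_le.
pose F u := J (z + k^-1 *: (b - C u)).
have Fc x y : `|F x - F y| <= 2^-1 * `|x - y|.
  apply: le_trans (Jn _ _) _.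
  rewrite opprD addrACA subrr add0r -scalerBr normrZ gtr0_norm ?invr_gt0 //.
  rewrite ler_pdivrMl // (_ : b - C x - (b - C y) = C y - C x); last first.
    by rewrite opprB addrC addrA subrK.
  rewrite distrC (le_trans (Cl _ _)) // mulrA ler_wpM2r // /k; lra.
pose G : {fun [set: H] >-> [set: H]} := HB.pack F (isFun.Build _ _ setT setT F (fun _ _ => I)).
have [|||u _ uE] := @banach_fixed_point _ _ setT G.
- exists (NngNum (ltac:(lra) : 0 <= 2^-1 :> R)); split=> /=; first lra.
  by move=> [x y] _; exact: Fc.
- exact: closedT.
- by exists 0.
exists u, (k *: (z + k^-1 *: (b - C u)) - k *: u); split.
  by rewrite {1 3}uE; exact: hJ.
rewrite scalerDr scalerA divff ?gt_eqF // scale1r scalerBr.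
by rewrite [_ + (b - C u) - _]addrAC -[_ + C u]addrA subrK addrK.
Qed.

End MaximalMonotone.

(** * Ultrafilters and real sequences *)

Section Ultrafilters.

(** Compactness of [[-K, K]] gives a cluster point, and an ultrafilter converges to each of its
    cluster points. *)
Lemma ultra_bounded_cvg {R : realType} (T : Type) (U : set_system T) (f : T -> R) (K : R) :
  UltraFilter U -> (forall t, `|f t| <= K) -> exists l : R, f @ U --> l.
Proof.
move=> UU fK.
have [l [_ cl]] : [set` `[- K, K]] `&` cluster (f @ U) !=set0.
  apply: segment_compact; apply: nearW => t /=.
  by rewrite in_itv /= -ler_norml.
exists l => A Al; have [//|nA] := in_ultra_setVsetC (f @^-1` A) UU.
by have [r [/= ]] := cl (~` A) A nA Al.
Qed.

(** It plays the role of extracting subsequences. If a neighbourhood [A] were missed, the trace of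
    [F] on the complement of its preimage would be proper, and an ultrafilter refining this trace
    could not converge to [l]. *)
Lemma cvg_ultra {T : Type} {V : topologicalType} (F : set_system T)
    {FF : ProperFilter F} (f : T -> V) (l : V) :
  (forall U, UltraFilter U -> F `<=` U -> f @ U --> l) -> f @ F --> l.
Proof.
move=> h A Al; apply: contrapT => nFA.
pose D := ~` (f @^-1` A).
have PD : ProperFilter (within D F).
  apply: Build_ProperFilter_ex => B FB; apply: contrapT => nB.
  have {}FB : F [set x | D x -> B x] by [].
  apply: nFA; suff : F (f @^-1` A) by [].
  by apply: (filterS _ FB) => x hx; apply: contrapT => nAx; apply: nB; exists x; exact: hx.
have [U [UU sU]] := ultraFilterLemma PD.
have UD : U D by apply: sU; exact: withinT.
have FU : F `<=` U by move=> B FB; apply: sU; apply: (filterS _ FB) => x Bx _.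
have UA : U (f @^-1` A) by exact: (h U UU FU A Al).
by have [x [Ax]] := @filter_ex _ U _ _ (filterI UA UD).
Qed.

(** The limits of [inner (z t) y] along [U] depend linearly and boundedly on [y], so Riesz's theorem
    represents them by a vector. *)
Lemma ultra_weak_cvg {R : realType} {H : hilbertType R} (T : Type) (U : set_system T)
    (z : T -> H) (K : R) :
  UltraFilter U -> (forall t, `|z t| <= K) ->
  exists l, forall y, inner (z t) y @[t --> U] --> inner l y.
Proof.
move=> UU zK.
have /choice[g hg] : forall y, exists l : R, inner (z t) y @[t --> U] --> l.
  move=> y; apply: (@ultra_bounded_cvg _ _ _ _ (K * `|y|)) => t.
  by apply: le_trans (normr_inner_le _ _) _; rewrite ler_wpM2r.
have [||l hl] := @riesz _ _ g K.
- move=> a x y.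
  have h : inner (z t) (a *: x + y) @[t --> U] --> a * g x + g y.
    under eq_fun do rewrite innerDr innerZr.
    by apply: cvgD => //; exact: cvgMr.
  by apply: cvg_unique (hg _) h; exact: norm_hausdorff.
- move=> x; pose c : R := K * `|x|.
  have hx t : inner (z t) x <= c.
    by apply: le_trans (inner_le _ _) _; rewrite ler_wpM2r.
  apply: (cvgr_to_le (hg x)); exact: nearW.
by exists l => y; rewrite innerC -hl.
Qed.

End Ultrafilters.

Section RealSequences.
Context {R : realType}.
Implicit Types (f u : nat -> R).

Lemma sumr_nat_ge0 (m n : nat) u : (forall k, (m <= k)%N -> 0 <= u k) ->
  0 <= \sum_(m <= k < n) u k.
Proof. by move=> h; rewrite big_nat; apply: sumr_ge0 => k /andP[/h]. Qed.

(** The limit is the fixed point [l / (1 - a)]. The distance to it shrinks by the factor [a] up to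
    an error [(1 - a) e / 2], and such errors accumulate geometrically to at most [e / 2]. *)
Lemma cvg_affine_rec (a : R) f (l : R) : 0 <= a -> a < 1 ->
  f n.+1 - a * f n @[n --> \oo] --> l -> cvgn f.
Proof.
move=> a0 a1 hl; pose c := l / (1 - a).
have d0 : 0 < 1 - a by lra.
suff : f @ \oo --> c by apply: cvgP.
apply/cvgrPdist_le => e e0.
have e2 : 0 < (1 - a) * (e / 2) by rewrite mulr_gt0 // divr_gt0.
have [N _ hN] := (cvgrPdist_le _ _).1 hl _ e2.
have step n : (N <= n)%N -> `|c - f n.+1| <= a * `|c - f n| + (1 - a) * (e / 2).
  move=> /hN /= h.
  have -> : c - f n.+1 = a * (c - f n) + (l - (f n.+1 - a * f n)).
    by rewrite /c; field; lra.
  apply: le_trans (ler_normD _ _) _; apply: lerD h.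
  by rewrite normrM ger0_norm.
have stepk k : `|c - f (k + N)%N| <= a ^+ k * `|c - f N| + e / 2.
  elim: k => [|k IH]; first by rewrite add0n expr0 mul1r; lra.
  rewrite addSn; apply: le_trans (step _ (leq_addl _ _)) _.
  have := ler_wpM2l a0 IH; rewrite exprS; lra.
have : a ^+ k * `|c - f N| @[k --> \oo] --> 0 * `|c - f N|.
  by apply: cvgMl; apply: cvg_expr; rewrite ger0_norm.
rewrite mul0r => /cvgrPdist_le/(_ (e / 2))/=.
have e20 : 0 < e / 2 by lra.
move=> /(_ e20)[M _ hM].
exists (M + N)%N => // n /= Mn.
have Nn : (N <= n)%N by apply: leq_trans Mn; exact: leq_addl.
rewrite -(subnK Nn); apply: le_trans (stepk _) _.
have /hM : (M <= n - N)%N by rewrite leq_subRL // addnC.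
rewrite /= sub0r normrN => /(le_trans (ler_norm _)); lra.
Qed.

(** A Cesaro argument: the terms from [N] on are close to [l], and the fixed head [M] is dominated
    by the unbounded total weight. The 1 in the maximum keeps that weight positive. *)
Lemma weighted_mean_cvg (lam t : nat -> R) (l : R) :
  (forall n, (1 <= n)%N -> 0 < lam n) ->
  (forall K, exists n, K <= \sum_(1 <= k < n.+1) lam k) ->
  t @ \oo --> l ->
  (\sum_(1 <= k < n.+1) lam k)^-1 * (\sum_(1 <= k < n.+1) lam k * t k) @[n --> \oo] --> l.
Proof.
move=> lam0 laminf tl; apply/cvgrPdist_le => e e0.
have e20 : 0 < e / 2 by lra.
have [N _ hN] := (cvgrPdist_le _ _).1 tl _ e20.
pose tau n := \sum_(1 <= k < n.+1) lam k.
pose M := \sum_(1 <= k < N.+1) lam k * `|l - t k|.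
have M0 : 0 <= M.
  by apply: sumr_nat_ge0 => k k1; rewrite mulr_ge0 // ltW // lam0.
have tau_nd n m : (n <= m)%N -> tau n <= tau m.
  move=> nm; rewrite /tau (@big_cat_nat _ _ _ n.+1 1 m.+1) //= lerDl.
  by apply: sumr_nat_ge0 => k k1; rewrite ltW // lam0 // (leq_trans _ k1).
have [n1 hn1] := laminf (Num.max 1 (2 * M / e)).
exists (maxn N n1) => // n /=; rewrite geq_max => /andP[Nn n1n].
have taun : Num.max 1 (2 * M / e) <= tau n by apply: le_trans hn1 _; exact: tau_nd.
have tau0 : 0 < tau n by apply: lt_le_trans taun; rewrite lt_max ltr01.
have -> : l - (tau n)^-1 * (\sum_(1 <= k < n.+1) lam k * t k) =
    (tau n)^-1 * \sum_(1 <= k < n.+1) lam k * (l - t k).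
  under [in RHS]eq_bigr do rewrite mulrBr.
  by rewrite sumrB -mulr_suml -/(tau n) mulrBr mulKf // gt_eqF.
rewrite normrM gtr0_norm ?invr_gt0 // ler_pdivrMl //.
apply: le_trans (ler_norm_sum _ _ _) _.
have -> : \sum_(1 <= k < n.+1) `|lam k * (l - t k)| = \sum_(1 <= k < n.+1) lam k * `|l - t k|.
  apply: eq_big_nat => k /andP[k1 _]; rewrite normrM gtr0_norm // lam0 //.
rewrite (@big_cat_nat _ _ _ N.+1 1 n.+1) //= -/M.
have : \sum_(N.+1 <= k < n.+1) lam k * `|l - t k| <= tau n * (e / 2).
  rewrite /tau mulr_suml (@big_cat_nat _ _ _ N.+1 1 n.+1) //=.
  apply: ler_wpDl.
    by apply: sumr_nat_ge0 => k k1; rewrite mulr_ge0 ?(ltW e20) // ltW // lam0.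
  apply: ler_sum_nat => k /andP[k1 _]; rewrite ler_wpM2l //.
    by rewrite ltW // lam0 // (leq_trans _ k1).
  by apply: hN; exact: ltnW.
have : M <= tau n * (e / 2).
  have : 2 * M / e <= tau n by apply: le_trans taun; rewrite le_max lexx orbT.
  by rewrite ler_pdivrMr //; lra.
lra.
Qed.

(** The numerators stay below a constant while the total weight is unbounded. Only the tail after
    [n1] is controlled by assumption; the head is the constant [F]. *)
Lemma weighted_mean_le0 (lam t : nat -> R) (U : set_system nat) (K l : R) (n1 : nat) :
  ProperFilter U -> \oo `<=` U ->
  (forall n, (1 <= n)%N -> 0 < lam n) ->
  (forall K, exists n, K <= \sum_(1 <= k < n.+1) lam k) ->
  (forall n, \sum_(k < n) lam (k + n1).+1 * t (k + n1).+1 <= K) ->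
  (\sum_(1 <= k < n.+1) lam k)^-1 * (\sum_(1 <= k < n.+1) lam k * t k) @[n --> U] --> l ->
  l <= 0.
Proof.
move=> PU sU lam0 laminf tK hl; pose tau n := \sum_(1 <= k < n.+1) lam k.
pose F := \sum_(1 <= k < n1.+1) lam k * t k.
have Kt n : (n1 <= n)%N -> \sum_(1 <= k < n.+1) lam k * t k <= F + K.
  move=> n1n; rewrite (@big_cat_nat _ _ _ n1.+1 1 n.+1) //= lerD2l.
  rewrite -{1}[n1.+1]add0n -(subnK n1n) -addnS big_addn addnK big_mkord.
  by apply: le_trans (tK (n - n1)%N); apply: ler_sum => k _; rewrite addnS.
apply/ler_addgt0Pr => e e0; rewrite add0r.
apply: (cvgr_to_le hl); apply: sU.
have [n2 hn2] := laminf (Num.max 1 ((F + K) / e)).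
exists (maxn n1 n2) => // n /=; rewrite geq_max => /andP[n1n n2n].
have : Num.max 1 ((F + K) / e) <= tau n.
  apply: le_trans hn2 _; rewrite /tau (@big_cat_nat _ _ _ n2.+1 1 n.+1) //= lerDl.
  by apply: sumr_nat_ge0 => k k1; rewrite ltW // lam0 // (leq_trans _ k1).
rewrite ge_max => /andP[tau1 tauK].
have tau0 : 0 < tau n by apply: lt_le_trans tau1.
rewrite -/(tau n) ler_pdivrMl //; apply: le_trans (Kt _ n1n) _.
by move: tauK; rewrite ler_pdivrMr.
Qed.

Lemma partial_sums_cvg u (K : R) : (forall n, 0 <= u n) ->
  (forall n, \sum_(k < n) u k <= K) -> cvgn (fun n => \sum_(k < n) u k).
Proof.
move=> u0 uK; apply: nondecreasing_is_cvgn.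
  by apply/nondecreasing_seqP => n; rewrite big_ord_recr /= lerDl.
by exists K => _ [n _ <-].
Qed.

Lemma partial_sums_cvg0 u (K : R) : (forall n, 0 <= u n) ->
  (forall n, \sum_(k < n) u k <= K) -> u @ \oo --> 0.
Proof.
move=> u0 uK; have cv := partial_sums_cvg u0 uK.
pose S n := \sum_(k < n) u k; have c1 : S @ \oo --> limn S by exact: cv.
have c2 : (fun n => S n.+1) @ \oo --> limn S by move: c1; rewrite -cvg_shiftS.
have -> : u = (fun n => S n.+1 - S n).
  by apply/funext => n; rewrite /S big_ord_recr /= addrAC subrr add0r.
by rewrite -(subrr (limn S)); exact: cvgB.
Qed.

End RealSequences.

(* [phi], [d], [e] are the squared distances to a solution, the squared increments
   and the summable errors of an inertial iteration. *)
Section InertialFejer.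
Context {R : realType}.
Variables (phi d g e al : nat -> R) (a s : R).
Hypothesis phi0 : forall n, 0 <= phi n.
Hypothesis d0 : forall n, 0 <= d n.
Hypothesis g0 : forall n, 0 <= g n.
Hypothesis al0 : forall n, 0 <= al n.
Hypothesis ala : forall n, al n <= a.
Hypothesis alS : forall n, al n <= al n.+1.
Hypothesis a1 : a < 1.
Hypothesis s0 : 0 < s.
Hypothesis fejer : forall n,
  phi n.+2 - phi n.+1 - al n * (phi n.+1 - phi n)
  <= 2 * al n * d n - (2 * a + s) * d n.+1 - g n + e n.

(** The Lyapunov quantity of the inertial scheme. It decreases up to the errors [e]: monotonicity of
    [al] absorbs the change of inertial weight, and [2 a d n.+1] pays for the new increment. *)
Let mu n := phi n.+1 - al n * phi n + 2 * al n * d n.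

Let a0 : 0 <= a. Proof. exact: le_trans (ala 0). Qed.

Let muS n : mu n.+1 <= mu n - s * d n.+1 - g n + e n.
Proof.
have := fejer n; rewrite /mu.
have : (al n.+1 - al n) * phi n.+1 >= 0 by rewrite mulr_ge0 // subr_ge0.
have : (a - al n.+1) * d n.+1 >= 0 by rewrite mulr_ge0 // subr_ge0.
lra.
Qed.

Lemma fejer_telescope n :
  mu n + \sum_(k < n) (s * d k.+1 + g k) <= mu 0 + \sum_(k < n) e k.
Proof.
elim: n => [|n IH]; first by rewrite !big_ord0.
rewrite !big_ord_recr /=; have := muS n; lra.
Qed.

Let mu_ge n : phi n.+1 - a * phi n <= mu n.
Proof.
rewrite /mu; have : 0 <= (a - al n) * phi n by rewrite mulr_ge0 // subr_ge0.
have : 0 <= al n * d n by rewrite mulr_ge0.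
lra.
Qed.

Let sum_ge0 n : 0 <= \sum_(k < n) (s * d k.+1 + g k).
Proof. by apply: sumr_ge0 => k _; rewrite addr_ge0 // mulr_ge0 // ltW. Qed.

(** Telescoping gives [phi n.+1 <= a * phi n + K'], and [B] is chosen so that this recursion cannot
    leave the range below it. *)
Lemma fejer_bounded (K : R) : (forall n, \sum_(k < n) e k <= K) ->
  exists B, forall n, phi n <= B.
Proof.
move=> eK; pose K' := mu 0 + K.
have a10 : 0 < 1 - a by rewrite subr_gt0.
pose B := Num.max (phi 0) (K' / (1 - a)); exists B.
elim=> [|n IH]; first by rewrite le_max lexx.
have : K' / (1 - a) <= B by rewrite le_max lexx orbT.
rewrite ler_pdivrMr // => BK.
have := mu_ge n; have := fejer_telescope n; have := sum_ge0 n; have := eK n.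
have := ler_wpM2l a0 IH; rewrite /K' in BK; lra.
Qed.

(** Boundedness of [phi] bounds [mu] from below by [- a B]. The errors may have any sign here, as
    those of a graph point with nonzero [w] do. *)
Lemma fejer_sum_le (B : R) : (forall n, phi n <= B) -> exists C, forall n,
  \sum_(k < n) (s * d k.+1 + g k) <= C + \sum_(k < n) e k.
Proof.
move=> phiB; exists (mu 0 + a * B) => n; have := fejer_telescope n; have := mu_ge n.
have := ler_wpM2l a0 (phiB n); have := phi0 n.+1; lra.
Qed.

(** Subtracting the partial sums of [e] makes [mu] nonincreasing and bounded below, so [mu]
    converges. As [d] tends to 0 and [al] converges, [phi n.+1 - limn al * phi n] converges too, and
    [cvg_affine_rec] applies. *)
Lemma fejer_cvg (K : R) : (forall n, 0 <= e n) ->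
  (forall n, \sum_(k < n) e k <= K) -> cvgn phi.
Proof.
move=> e0 eK; have [B phiB] := fejer_bounded eK.
have [D hD] := fejer_sum_le phiB.
have dsum n : \sum_(k < n) s * d k.+1 <= D + K.
  apply: (@le_trans _ _ (\sum_(k < n) (s * d k.+1 + g k))).
    by apply: ler_sum => k _; rewrite lerDl.
  by apply: le_trans (hD n) _; rewrite lerD2l.
have dcv : d @ \oo --> 0.
  have sd0 n : 0 <= s * d n.+1 by rewrite mulr_ge0 // ltW.
  have h := cvgMr (a := s^-1) (partial_sums_cvg0 sd0 dsum).
  rewrite mulr0 in h; rewrite -cvg_shiftS.
  have -> : (fun n => d n.+1) = (fun n => s^-1 * (s * d n.+1)).
    by apply/funext => n; rewrite mulKf // lt0r_neq0.
  exact: h.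
have ecv := partial_sums_cvg e0 eK.
have alcv : cvgn al.
  apply: nondecreasing_is_cvgn; first exact/nondecreasing_seqP.
  by exists a => _ [n _ <-].
have ala_lim : limn al <= a.
  by apply: (ler_cvg_to alcv (cvg_cst a)); exact: nearW.
have al_lim0 : 0 <= limn al.
  by apply: (ler_cvg_to (cvg_cst 0) alcv); exact: nearW.
have mucv : cvgn mu.
  have nucv : cvgn (fun n => mu n - \sum_(k < n) e k).
    apply: nonincreasing_is_cvgn.
      apply/nonincreasing_seqP => n; rewrite big_ord_recr /=.
      have := muS n; have := g0 n; have := mulr_ge0 (ltW s0) (d0 n.+1); lra.
    exists (- a * B - K) => _ [n _ <-].
    have := mu_ge n; have := ler_wpM2l a0 (phiB n); have := phi0 n.+1.
    have := eK n; lra.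
  have -> : mu = fun n => (mu n - \sum_(k < n) e k) + \sum_(k < n) e k.
    by apply/funext => n; rewrite subrK.
  exact: is_cvgD.
have alphi : (limn al - al n) * phi n @[n --> \oo] --> 0.
  have B0 : 0 <= B by apply: le_trans (phi0 0) (phiB 0).
  apply: (@squeeze_cvgr _ _ _ _ (fun=> 0) (fun n => (limn al - al n) * B)).
  - apply: nearW => n; rewrite mulr_ge0 ?ler_wpM2l //= subr_ge0.
      by apply: nondecreasing_cvgn_le => //; exact/nondecreasing_seqP.
    by apply: nondecreasing_cvgn_le => //; exact/nondecreasing_seqP.
  - exact: cvg_cst.
  - rewrite -[X in _ --> X](mul0r B) -(subrr (limn al)).
    by apply: cvgMl; apply: cvgB => //; exact: cvg_cst.
have ald : 2 * al n * d n @[n --> \oo] --> 0.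
  rewrite -[X in _ --> X](mulr0 (2 * limn al)).
  by apply: cvgM => //; exact: cvgMr.
apply: (@cvg_affine_rec _ (limn al) _ (limn mu)) => //; first exact: le_lt_trans a1.
have -> : (fun n => phi n.+1 - limn al * phi n) =
    (fun n => mu n - 2 * al n * d n - (limn al - al n) * phi n).
  by apply/funext => n; rewrite /mu; ring.
rewrite -[X in _ --> X]subr0 -[X in _ --> X - _]subr0.
by apply: cvgB => //; exact: cvgB.
Qed.

End InertialFejer.

(** * The inertial iteration in a finite product of Hilbert spaces *)

(** The right-hand side equals [a * |(p - x) - (x - x')|^2]. *)
Lemma inertial_step {R : realType} {H : hilbertType R} (a : R) (x' x p y u : H) :
  0 <= a ->
  0 <= 2 * a * `|x - x'| ^+ 2 - (1 - a) * `|p - x| ^+ 2 + `|p - y| ^+ 2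
    + 2 * inner (p - u) (y - x - a *: (x - x'))
    - `|y - u| ^+ 2 + (1 + a) * `|x - u| ^+ 2 - a * `|x' - u| ^+ 2.
Proof.
move=> a0; have := mulr_ge0 a0 (sqr_ge0 `|(p - x) - (x - x')|).
congr (_ <= _); rewrite -!inner_sqr !innerE.
rewrite ?(innerC x x') ?(innerC p x') ?(innerC p x) ?(innerC y x') ?(innerC y x) ?(innerC y p).
rewrite ?(innerC u x') ?(innerC u x) ?(innerC u p) ?(innerC u y).
ring.
Qed.

Section Family.
Context {R : realType} {J : finType} {E : J -> hilbertType R}.

(** With [nsq], the inner product and squared norm of the Hilbert sum of the [E j], whose elements
    are represented as dependent families. *)
Definition dot (u w : forall j, E j) : R := \sum_j inner (u j) (w j).
Definition nsq (u : forall j, E j) : R := \sum_j `|u j| ^+ 2.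

Lemma nsq_ge0 u : 0 <= nsq u.
Proof. by apply: sumr_ge0 => j _; exact: sqr_ge0. Qed.

Lemma nsq_le u j : `|u j| ^+ 2 <= nsq u.
Proof. by rewrite /nsq (bigD1 j) //= lerDl; apply: sumr_ge0 => i _; exact: sqr_ge0. Qed.

Lemma nsqD_le u w : nsq (fun j => u j + w j) <= 2 * nsq u + 2 * nsq w.
Proof.
rewrite /nsq !mulr_sumr -big_split /=; apply: ler_sum => j _; exact: normD_sqr_le.
Qed.

Lemma dotDl u v w : dot (fun j => u j + v j) w = dot u w + dot v w.
Proof. by rewrite /dot -big_split; apply: eq_bigr => j _; rewrite innerDl. Qed.

Lemma dotNl u w : dot (fun j => - u j) w = - dot u w.
Proof. by rewrite /dot -sumrN; apply: eq_bigr => j _; rewrite innerNl. Qed.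

Lemma dotBl u v w : dot (fun j => u j - v j) w = dot u w - dot v w.
Proof. by rewrite dotDl dotNl. Qed.

Lemma dot_young (c : R) u w : 0 < c -> 2 * dot u w <= c * nsq u + c^-1 * nsq w.
Proof.
move=> c0; rewrite /dot /nsq !mulr_sumr -big_split /=; apply: ler_sum => j _.
have := mulr_ge0 (ltW c0) (sqr_ge0 `|u j - c^-1 *: w j|).
rewrite -!inner_sqr !innerE (innerC (w j) (u j)).
have : c * c^-1 = 1 by rewrite divff // gt_eqF.
move: (inner (u j) (w j)) (inner (u j) (u j)) (inner (w j) (w j)) (c^-1) => A B C D h h2.
have hA : c * D * A = A by rewrite h mul1r.
have hC : c * D * (D * C) = D * C by rewrite h mul1r.
lra.
Qed.

(** The identity behind Opial's argument: the difference of the squared distances to two points is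
    affine in [x]. *)
Lemma nsqB_diff x u v :
  nsq (fun j => x j - u j) - nsq (fun j => x j - v j) =
  nsq u - nsq v - 2 * dot x (fun j => u j - v j).
Proof.
rewrite /nsq /dot mulr_sumr -!sumrB; apply: eq_bigr => j _.
by rewrite !normB_sqr innerBr; ring.
Qed.

End Family.

(** The squared gap [Q] between [P n] and [X n] pays for all losses: [N] is at most [t2 * Q] and
    [I'] at most [2 N + 2 Q]. Of the coefficient [5 a + 2 s], [4 a + s] goes to [I'], [a] to the
    inertia, and [s / 2] each to Young's inequality and to the gain kept. *)
Lemma inertial_arith {R : realType} (a s al t2 N Q I I' d d' d'' h lW lX q lgQ D : R) :
  0 <= a -> 0 < s -> al <= a -> 0 <= Q -> 0 <= t2 ->
  5 * a + 2 * s + (1 + 4 * a + 2 * s) * t2 <= 1 ->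
  N <= t2 * Q -> I' <= 2 * N + 2 * Q ->
  D <= h + lW - lgQ ->
  2 * lW <= 2 * lX + s / 2 * Q + q ->
  0 <= 2 * al * I - (1 - al) * Q + N + 2 * D - d'' + (1 + al) * d' - al * d ->
  d'' - d' - al * (d' - d) <=
    2 * al * I - (2 * a + s / 2) * I' - (s / 2 * Q + 2 * lgQ) + (2 * h + q + 2 * lX).
Proof.
move=> a0 s0 ala Q0 t0 par hN hI hD hW.
have q1 : 0 <= Q * (1 - (5 * a + 2 * s + (1 + 4 * a + 2 * s) * t2)).
  by rewrite mulr_ge0 // subr_ge0.
have q2 : 0 <= (a - al) * Q by rewrite mulr_ge0 // subr_ge0.
have q3 : (2 * a + s / 2) * I' <= (2 * a + s / 2) * (2 * N + 2 * Q).
  by rewrite ler_wpM2l //; lra.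
have q4 : 0 <= s * (t2 * Q) by apply: mulr_ge0; [exact: ltW|exact: mulr_ge0].
have q6 : (4 * a + s + 1) * N <= (4 * a + s + 1) * (t2 * Q).
  by rewrite ler_wpM2l //; lra.
lra.
Qed.

(** * Weak ergodic and strong convergence of the inertial iteration *)

Section InertialErgodic.
Context {R : realType} {J : finType} {E : J -> hilbertType R}.
Local Notation fam := (forall j, E j).
Variables (X P : nat -> fam) (lam al th : nat -> R) (a s gam : R) (n1 : nat).
(** [W u w] is membership of [(u, w)] in the graph of an abstract operator on the product; of its
    maximality, [W_maximal] records the case [w = 0]. *)
Variable W : fam -> fam -> Prop.
Hypothesis a0 : 0 <= a.
Hypothesis s0 : 0 < s.
Hypothesis gam0 : 0 <= gam.
Hypothesis lam0 : forall n, (0 < n)%N -> 0 < lam n.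
Hypothesis alP : forall n, (n1 < n)%N -> 0 <= al n <= a.
Hypothesis alS : forall n, (n1 < n)%N -> al n <= al n.+1.
Hypothesis param : forall n, (n1 < n)%N ->
  5 * a + 2 * s + (1 + 4 * a + 2 * s) * th n ^+ 2 <= 1.
Hypothesis step_lip : forall n, (n1 < n)%N ->
  nsq (fun j => P n j - X n.+1 j) <= th n ^+ 2 * nsq (fun j => P n j - X n j).
Hypothesis step_mono : forall u w, W u w -> exists h : nat -> R,
  [/\ forall n, (n1 < n)%N -> 0 <= h n,
      exists K : R, forall n, \sum_(k < n) h (k + n1).+1 <= K &
      forall n, (n1 < n)%N ->
      dot (fun j => P n j - u j)
          (fun j => X n.+1 j - X n j - al n *: (X n j - X n.-1 j))
      <= h n + lam n * dot (fun j => u j - P n j) w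
         - lam n * gam * nsq (fun j => P n j - u j)].
Hypothesis lam_sq : exists K : R, forall n, \sum_(k < n) lam (k + n1).+1 ^+ 2 <= K.
Hypothesis lam_inf : forall K : R, exists n, K <= \sum_(1 <= k < n.+1) lam k.
Hypothesis W_maximal : forall z,
  (forall u w, W u w -> 0 <= dot (fun j => u j - z j) w) -> W z (fun=> 0).
Hypothesis W_zero : exists z, W z (fun=> 0).

Let dist u n := nsq (fun j => X n j - u j).
Let inc n := nsq (fun j => X n j - X n.-1 j).
Let gap n := nsq (fun j => P n j - X n j).

(** Sums [inertial_step] over the factors. Since the means are those of [X], Young's inequality
    replaces [P] by [X] in the pairing with [w], at the cost of part of the gap and of an error in
    [lam n ^+ 2]. *)
Lemma inertial_fejer u w h n : (n1 < n)%N -> W u w ->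
  dot (fun j => P n j - u j)
      (fun j => X n.+1 j - X n j - al n *: (X n j - X n.-1 j))
      <= h n + lam n * dot (fun j => u j - P n j) w
         - lam n * gam * nsq (fun j => P n j - u j) ->
  dist u n.+1 - dist u n - al n * (dist u n - dist u n.-1) <=
    2 * al n * inc n - (2 * a + s / 2) * inc n.+1
    - (s / 2 * gap n + 2 * (lam n * gam * nsq (fun j => P n j - u j)))
    + (2 * h n + (s / 2)^-1 * (lam n ^+ 2 * nsq w)
       + 2 * (lam n * dot (fun j => u j - X n j) w)).
Proof.
move=> n1n Wuw hn; have /andP[al0 ala] := alP n1n.
have : 0 <= \sum_j (2 * al n * `|X n j - X n.-1 j| ^+ 2
    - (1 - al n) * `|P n j - X n j| ^+ 2 + `|P n j - X n.+1 j| ^+ 2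
    + 2 * inner (P n j - u j) (X n.+1 j - X n j - al n *: (X n j - X n.-1 j))
    - `|X n.+1 j - u j| ^+ 2 + (1 + al n) * `|X n j - u j| ^+ 2
    - al n * `|X n.-1 j - u j| ^+ 2).
  by apply: sumr_ge0 => j _; exact: inertial_step.
rewrite !big_split /= !sumrN -!mulr_sumr.
rewrite -[\sum_j `|X n.+1 j - u j| ^+ 2]/(dist u n.+1) -[\sum_j `|X n j - u j| ^+ 2]/(dist u n).
rewrite -[\sum_j `|X n.-1 j - u j| ^+ 2]/(dist u n.-1) -[\sum_j `|X n j - X n.-1 j| ^+ 2]/(inc n).
rewrite -[\sum_j `|P n j - X n j| ^+ 2]/(gap n).
rewrite -[\sum_j inner _ _]/(dot (fun j => P n j - u j)
  (fun j => X n.+1 j - X n j - al n *: (X n j - X n.-1 j))).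
rewrite -[\sum_j `|P n j - X n.+1 j| ^+ 2]/(nsq (fun j => P n j - X n.+1 j)).
have lipn := step_lip n1n; rewrite -/(gap n) in lipn.
have incS : inc n.+1 <= 2 * nsq (fun j => P n j - X n.+1 j) + 2 * gap n.
  rewrite /inc /gap /nsq !mulr_sumr -big_split /=; apply: ler_sum => j _.
  rewrite (_ : X n.+1 j - X n j = (P n j - X n j) - (P n j - X n.+1 j)).
    by rewrite addrC (le_trans (normD_sqr_le _ _)) // normrN.
  by rewrite [RHS]addrC opprB addrA subrK.
have dotP : 2 * (lam n * dot (fun j => u j - P n j) w) <=
    2 * (lam n * dot (fun j => u j - X n j) w)
    + s / 2 * gap n + (s / 2)^-1 * (lam n ^+ 2 * nsq w).
  have s20 : 0 < s / 2 by rewrite divr_gt0.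
  have := @dot_young _ _ _ (s / 2) (fun j => X n j - P n j) (fun j => lam n *: w j) s20.
  have -> : nsq (fun j => X n j - P n j) = gap n.
    by apply: eq_bigr => j _; rewrite distrC.
  have -> : nsq (fun j => lam n *: w j) = lam n ^+ 2 * nsq w.
    by rewrite /nsq mulr_sumr; apply: eq_bigr => j _; rewrite normrZ exprMn real_normK ?num_real.
  have -> : dot (fun j => X n j - P n j) (fun j => lam n *: w j) =
      lam n * (dot (fun j => u j - P n j) w - dot (fun j => u j - X n j) w).
    rewrite /dot -sumrB mulr_sumr; apply: eq_bigr => j _.
    rewrite innerZr -innerBl; congr (_ * inner _ _).
    by rewrite [RHS]addrC opprB addrA subrK.
  lra.
move=> hstep.
apply: (inertial_arith a0 s0 ala (nsq_ge0 _) (sqr_ge0 (th n)) (param n1n) lipn incS hn dotP).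
exact: hstep.
Qed.

Let a1 : a < 1.
Proof.
have := param (leqnn n1.+1); have := a0; have := s0.
have : 0 <= (1 + 4 * a + 2 * s) * th n1.+1 ^+ 2.
  by apply: mulr_ge0; [have := a0; have := s0; lra|exact: sqr_ge0].
lra.
Qed.

Let s20 : 0 < s / 2. Proof. by rewrite divr_gt0. Qed.

(** Gains, and below errors, at the index [(k + n1).+1]: after this shift the assumptions made for
    [n1 < n] hold from [k = 0] on. *)
Let g u k := s / 2 * gap (k + n1).+1
  + 2 * (lam (k + n1).+1 * gam * nsq (fun j => P (k + n1).+1 j - u j)).

Let err (h : nat -> R) u w k := 2 * h (k + n1).+1
  + (s / 2)^-1 * (lam (k + n1).+1 ^+ 2 * nsq w)
  + 2 * (lam (k + n1).+1 * dot (fun j => u j - X (k + n1).+1 j) w).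

Let n1k k : (n1 < (k + n1).+1)%N. Proof. by rewrite ltnS leq_addl. Qed.

Let g0 u k : 0 <= g u k.
Proof.
rewrite /g addr_ge0 // mulr_ge0 ?nsq_ge0 ?(ltW s20) //.
by rewrite mulr_ge0 ?nsq_ge0 // mulr_ge0 // ltW // lam0.
Qed.

Let fejerP u w h : W u w ->
  (forall n, (n1 < n)%N ->
      dot (fun j => P n j - u j)
          (fun j => X n.+1 j - X n j - al n *: (X n j - X n.-1 j))
      <= h n + lam n * dot (fun j => u j - P n j) w
         - lam n * gam * nsq (fun j => P n j - u j)) ->
  forall k, dist u (k.+2 + n1) - dist u (k.+1 + n1)
      - al (k + n1).+1 * (dist u (k.+1 + n1) - dist u (k + n1)) <=
    2 * al (k + n1).+1 * inc (k + n1).+1 - (2 * a + s / 2) * inc (k.+1 + n1).+1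
    - g u k + err h u w k.
Proof. by move=> Wuw hh k; exact: inertial_fejer (n1k k) Wuw (hh _ (n1k k)). Qed.

Let err0 h u k : err h u (fun=> 0) k = 2 * h (k + n1).+1.
Proof.
rewrite /err (_ : nsq _ = 0); last by apply: big1 => j _; rewrite normr0 expr0n.
rewrite (_ : dot _ _ = 0); last by apply: big1 => j _; rewrite inner0r.
by rewrite !mulr0 !addr0.
Qed.

Let dist_ge0 u n : 0 <= dist u n. Proof. exact: nsq_ge0. Qed.
Let inc_ge0 n : 0 <= inc n. Proof. exact: nsq_ge0. Qed.
Let al_ge0 k : 0 <= al (k + n1).+1. Proof. by case/andP: (alP (n1k k)). Qed.
Let al_le k : al (k + n1).+1 <= a. Proof. by case/andP: (alP (n1k k)). Qed.
Let al_S k : al (k + n1).+1 <= al (k.+1 + n1).+1. Proof. exact: alS. Qed.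

Lemma solution_dist_cvg u : W u (fun=> 0) -> cvgn (dist u).
Proof.
move=> Wu; have [h [h0 [K hK] hh]] := step_mono Wu.
have eK n : \sum_(k < n) err h u (fun=> 0) k <= 2 * K.
  by under eq_bigr do rewrite err0; rewrite -mulr_sumr ler_pM2l.
have e0 k : 0 <= err h u (fun=> 0) k by rewrite err0 mulr_ge0 // h0.
have /cvg_ex[l hl] := @fejer_cvg _ _ _ _ _ _ a (s / 2) (fun k => dist_ge0 u (k + n1))
  (fun k => inc_ge0 (k + n1).+1) (g0 u) al_ge0 al_le al_S a1 s20 (fejerP Wu hh) (2 * K) e0 eK.
by apply/cvg_ex; exists l; rewrite -(cvg_shiftn n1).
Qed.

(** The distances to some solution converge, and the triangle inequality passes from that solution
    to [u]. *)
Lemma dist_bounded u : exists B, forall n, dist u n <= B.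
Proof.
have [z Wz] := W_zero.
have [B [_ hB]] := cvg_seq_bounded (solution_dist_cvg Wz).
exists (2 * (B + 1) + 2 * nsq (fun j => z j - u j)) => n.
have zB : dist z n <= B + 1.
  have B1 : B < B + 1 by rewrite ltrDl.
  by apply: le_trans (hB _ B1 n I); exact: ler_norm.
have : dist u n <= 2 * dist z n + 2 * nsq (fun j => z j - u j).
  apply: le_trans (nsqD_le _ _); rewrite le_eqVlt; apply/orP; left; apply/eqP.
  by apply: eq_bigr => j _; rewrite addrA subrK.
lra.
Qed.

Lemma solution_gap_sum u : W u (fun=> 0) ->
  exists K, forall n, \sum_(k < n) g u k <= K.
Proof.
move=> Wu; have [h [h0 [K hK] hh]] := step_mono Wu.
have [B hB] := dist_bounded u.
have [D hD] := @fejer_sum_le _ _ _ _ _ _ a (s / 2) (fun k => dist_ge0 u (k + n1))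
  (fun k => inc_ge0 (k + n1).+1) al_ge0 al_le al_S (fejerP Wu hh) B
  (fun k => hB (k + n1)%N).
exists (D + 2 * K) => n.
apply: (@le_trans _ _ (\sum_(k < n) (s / 2 * inc (k.+1 + n1).+1 + g u k))).
  by apply: ler_sum => k _; rewrite lerDr mulr_ge0 // ltW.
apply: le_trans (hD n) _; rewrite lerD2l; under eq_bigr do rewrite err0.
by rewrite -mulr_sumr ler_pM2l.
Qed.

(** The gains are nonnegative, so the total error is bounded below; taking away its summable parts
    leaves minus twice the weighted sum. *)
Lemma graph_sum_le u w : W u w -> exists K, forall n,
  \sum_(k < n) lam (k + n1).+1 * dot (fun j => X (k + n1).+1 j - u j) w <= K.
Proof.
move=> Wuw; have [h [h0 [K hK] hh]] := step_mono Wuw.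
have [B hB] := dist_bounded u; have [L hL] := lam_sq.
have [D hD] := @fejer_sum_le _ _ _ _ _ _ a (s / 2) (fun k => dist_ge0 u (k + n1))
  (fun k => inc_ge0 (k + n1).+1) al_ge0 al_le al_S (fejerP Wuw hh) B
  (fun k => hB (k + n1)%N).
pose c := (s / 2)^-1 * nsq w.
have c0 : 0 <= c by rewrite mulr_ge0 ?nsq_ge0 // invr_ge0 ltW.
exists ((D + 2 * K + c * L) / 2) => n.
rewrite ler_pdivlMr // -subr_ge0.
have S0 : 0 <= \sum_(k < n) (s / 2 * inc (k.+1 + n1).+1 + g u k).
  by apply: sumr_ge0 => k _; rewrite addr_ge0 // mulr_ge0 // ltW.
apply: le_trans S0 _; apply: le_trans (hD n) _.
have -> : \sum_(k < n) err h u w k = 2 * (\sum_(k < n) h (k + n1).+1)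
    + c * (\sum_(k < n) lam (k + n1).+1 ^+ 2)
    - (\sum_(k < n) lam (k + n1).+1 * dot (fun j => X (k + n1).+1 j - u j) w) * 2.
  rewrite !mulr_sumr mulr_suml -big_split -sumrB; apply: eq_bigr => k _ /=.
  rewrite /err !dotBl /c; ring.
have h1 : 2 * (\sum_(k < n) h (k + n1).+1) <= 2 * K by rewrite ler_pM2l.
have h2 := ler_wpM2l c0 (hL n).
by rewrite -!addrA lerD2l !addrA lerD2r lerD.
Qed.

Lemma dot_mean n w : dot (fun j => ergodic_mean lam (fun k => X k j) n) w =
  (\sum_(1 <= k < n.+1) lam k)^-1 * \sum_(1 <= k < n.+1) lam k * dot (X k) w.
Proof.
have -> : \sum_(1 <= k < n.+1) lam k * dot (X k) w =
    \sum_j \sum_(1 <= k < n.+1) lam k * inner (X k j) (w j).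
  by rewrite exchange_big; apply: eq_bigr => k _; rewrite mulr_sumr.
rewrite /dot mulr_sumr; apply: eq_bigr => j _.
rewrite /ergodic_mean innerZl inner_suml; congr (_ * _).
by apply: eq_bigr => k _; rewrite innerZl.
Qed.

Lemma mean_bounded j : exists K, forall n, `|ergodic_mean lam (fun k => X k j) n| <= K.
Proof.
have [z _] := W_zero; have [B hB] := dist_bounded z.
(* The bound [t <= 1 + t ^ 2] turns a bound on the squared norm into one on the norm. *)
pose K := 1 + 2 * B + 2 * `|z j| ^+ 2.
have XK n : `|X n j| <= K.
  have := normD_sqr_le (X n j - z j) (z j); rewrite subrK.
  have : `|X n j - z j| ^+ 2 <= dist z n by exact: (nsq_le (fun j => X n j - z j)).
  have := hB n; have := sqr_ge0 (`|X n j| - 1); have := sqr_ge0 `|X n j|.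
  rewrite sqrrB1 /K; lra.
have K0 : 0 <= K by apply: le_trans (XK 0).
exists K => -[|n].
  by rewrite /ergodic_mean !big_geq // scaler0 normr0.
have tau0 : 0 < \sum_(1 <= k < n.+2) lam k.
  rewrite big_nat_recl // ltr_wpDr ?lam0 //.
  by apply: sumr_nat_ge0 => k _; rewrite ltW // lam0.
rewrite /ergodic_mean normrZ gtr0_norm ?invr_gt0 // ler_pdivrMl //.
apply: le_trans (ler_norm_sum _ _ _) _; rewrite mulr_suml.
apply: ler_sum_nat => k /andP[k1 _].
by rewrite normrZ gtr0_norm ?lam0 // ler_wpM2l // ltW // lam0.
Qed.

Lemma cvg_dot (w : fam) (T : Type) (F : set_system T) {FF : Filter F} (f : T -> fam) (l : fam) :
  (forall j y, inner (f t j) y @[t --> F] --> inner (l j) y) ->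
  dot (f t) w @[t --> F] --> dot l w.
Proof. by move=> h; apply: cvg_big => [|j _]; [exact: add_continuous|exact: h]. Qed.

(** For [(u, w)] in the graph, [graph_sum_le] and the unbounded total weight make the limit
    [dot l w - dot u w] of the means nonpositive, which is the premise of [W_maximal]. *)
Lemma ultra_limit_solution (U : set_system nat) (l : fam) :
  UltraFilter U -> \oo `<=` U ->
  (forall j y, inner (ergodic_mean lam (fun k => X k j) n) y @[n --> U] --> inner (l j) y) ->
  W l (fun=> 0).
Proof.
move=> UU sU hl; apply: W_maximal => u w Wuw.
rewrite dotBl subr_ge0 -subr_le0.
have [K hK] := graph_sum_le Wuw.
apply: (@weighted_mean_le0 _ lam (fun k => dot (fun j => X k j - u j) w) U K _ n1) => //.
have hd : dot (fun j => ergodic_mean lam (fun k => X k j) n) w - dot u w @[n --> U]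
    --> dot l w - dot u w.
  by apply: cvgB; [exact: cvg_dot|exact: cvg_cst].
apply: (cvg_trans _ hd); apply: near_eq_cvg; apply: sU; exists 1%N => // n n0.
have tau0 : \sum_(1 <= k < n.+1) lam k != 0.
  case: n n0 => // n _; rewrite gt_eqF // big_nat_recl // ltr_wpDr ?lam0 //.
  by apply: sumr_nat_ge0 => k _; rewrite ltW // lam0.
rewrite /= dot_mean.
have -> : \sum_(1 <= k < n.+1) lam k * dot (fun j => X k j - u j) w =
    \sum_(1 <= k < n.+1) (lam k * dot (X k) w - lam k * dot u w).
  by apply: eq_bigr => k _; rewrite dotBl mulrBr.
by rewrite sumrB -mulr_suml mulrBr mulKf.
Qed.

Theorem ergodic_weak_cvg :
  exists2 l, W l (fun=> 0) & forall j, weak_cvg (ergodic_mean lam (fun k => X k j)) (l j).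
Proof.
have ultra_lim (U : set_system nat) : UltraFilter U -> exists l : fam, forall j y,
    inner (ergodic_mean lam (fun k => X k j) n) y @[n --> U] --> inner (l j) y.
  move=> UU.
  have h j : exists l : E j, forall y,
      inner (ergodic_mean lam (fun k => X k j) n) y @[n --> U] --> inner l y.
    by have [K hK] := mean_bounded j; exact: (ultra_weak_cvg UU hK).
  by exists (fun j => projT1 (cid (h j))) => j; exact: projT2 (cid (h j)).
have [U0 [UU0 sU0]] := ultraFilterLemma eventually_filter.
have [l hl] := ultra_lim _ UU0.
have Wl := ultra_limit_solution UU0 sU0 hl.
(* It remains to see that the weak limit along any other ultrafilter is the same [l]. *)
exists l => // j y; apply: cvg_ultra => U UU sU.
have [l' hl'] := ultra_lim _ UU.
have Wl' := ultra_limit_solution UU sU hl'.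
suff ll' : forall i, l i = l' i by rewrite ll'; exact: hl'.
(* Both limits are solutions, so both distances converge, and with them their difference, which is
   affine in [X n]. *)
pose t n := dot (X n) (fun i => l i - l' i).
have tcv : cvgn t.
  have -> : t = fun n => 2^-1 * (nsq l - nsq l' - (dist l n - dist l' n)).
    by apply/funext => n; rewrite nsqB_diff /t; lra.
  apply: is_cvgMr; apply: is_cvgB; first exact: is_cvg_cst.
  by apply: is_cvgB; exact: solution_dist_cvg.
have mcv := weighted_mean_cvg lam0 lam_inf tcv.
(* The means of [t] converge along the whole sequence, so every ultrafilter limit [b] has the same
   product with [l - l']. Comparing [l] and [l'] gives [|l - l'|^2 = 0]. *)
have mean_dot (V : set_system nat) b : UltraFilter V -> \oo `<=` V ->
    (forall j y, inner (ergodic_mean lam (fun k => X k j) n) y @[n --> V] --> inner (b j) y) ->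
    dot b (fun i => l i - l' i) = limn t.
  move=> VV sV hb; have h1 := cvg_dot (w := fun i => l i - l' i) hb.
  have h2 : dot (fun j => ergodic_mean lam (fun k => X k j) n) (fun i => l i - l' i)
      @[n --> V] --> limn t.
    under eq_fun do rewrite dot_mean.
    by move=> A /mcv; exact: sV.
  by apply: cvg_unique (h1 _) h2; exact: norm_hausdorff.
have : nsq (fun i => l i - l' i) = 0.
  have -> : nsq (fun i => l i - l' i) = dot (fun i => l i - l' i) (fun i => l i - l' i).
    by apply: eq_bigr => i _; rewrite inner_sqr.
  by rewrite dotBl (mean_dot U0) // (mean_dot U) // subrr.
move=> n0 i; apply/eqP; rewrite -subr_eq0 -normr_eq0 -sqrf_eq0 eq_le sqr_ge0 andbT.
by rewrite -n0; exact: (nsq_le (fun i => l i - l' i)).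
Qed.

(** The distances converge, and their weighted means converge to the same limit. Each [lam * dist]
    is bounded by a multiple of a gain with bounded sums, so that limit is at most 0. *)
Theorem strong_cvg u : 0 < gam -> W u (fun=> 0) -> forall j, X n j @[n --> \oo] --> u j.
Proof.
move=> gam_gt0 Wu j; have dcv := solution_dist_cvg Wu.
have [K hK] := solution_gap_sum Wu; have [L hL] := lam_sq.
have L0 : 0 <= L by have := hL 0%N; rewrite big_ord0.
have lamL k : lam (k + n1).+1 <= 1 + L.
  have : lam (k + n1).+1 ^+ 2 <= L.
    apply: le_trans (hL k.+1); rewrite big_ord_recr /= lerDr.
    by apply: sumr_ge0 => i _; exact: sqr_ge0.
  have := sqr_ge0 (lam (k + n1).+1 - 1); rewrite sqrrB1.
  have := sqr_ge0 (lam (k + n1).+1); lra.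
(* The first summand turns the strong monotonicity gain into [2 lam Q]; the second turns
   [s / 2 * gap] into [2 (1 + L) gap], where [1 + L] bounds [lam]. *)
pose M := gam^-1 + 4 * (1 + L) / s.
have L1 : 0 <= 1 + L by rewrite addr_ge0.
have M0 : 0 <= M.
  by apply: addr_ge0; [rewrite invr_ge0|apply: divr_ge0; [exact: mulr_ge0|exact: ltW]].
have lim_le0 : limn (dist u) <= 0.
  apply: (@weighted_mean_le0 _ lam (dist u) \oo (M * K) _ n1) => //; last first.
    exact: weighted_mean_cvg.
  move=> n; apply: le_trans (ler_wpM2l M0 (hK n)); rewrite mulr_sumr.
  apply: ler_sum => k _; set m := (k + n1).+1.
  pose Q := nsq (fun j => P m j - u j).
  have dQ : dist u m <= 2 * Q + 2 * gap m.
    rewrite /dist /Q /gap /nsq !mulr_sumr -big_split /=; apply: ler_sum => i _.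
    rewrite (_ : X m i - u i = (P m i - u i) - (P m i - X m i)).
      by rewrite (le_trans (normD_sqr_le _ _)) // normrN.
    by rewrite [RHS]addrC opprB addrA subrK.
  have lm0 : 0 < lam m by exact: lam0.
  apply: le_trans (ler_wpM2l (ltW lm0) dQ) _.
  have Q0 : 0 <= Q by exact: nsq_ge0.
  have p0 : 0 <= gap m by exact: nsq_ge0.
  have -> : M * g u k = 2 * (lam m * Q) + 2 * (1 + L) * gap m
      + (gam^-1 * (s / 2 * gap m) + 4 * (1 + L) / s * (2 * (lam m * gam * Q))).
    by rewrite /M /g -/m -/Q; field; rewrite !gt_eqF.
  have : 0 <= gam^-1 * (s / 2 * gap m) + 4 * (1 + L) / s * (2 * (lam m * gam * Q)).
    apply: addr_ge0; first by rewrite !mulr_ge0 // ?invr_ge0 // ltW.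
    by rewrite !mulr_ge0 // ?invr_ge0 ?ltW //.
  have : lam m * gap m <= (1 + L) * gap m by rewrite ler_wpM2r // lamL.
  lra.
have d0 : dist u @ \oo --> 0.
  have -> : 0 = limn (dist u).
    apply/eqP; rewrite eq_le lim_le0 andbT; apply: (cvgr_to_ge dcv).
    by apply: nearW => n; exact: dist_ge0.
  exact: dcv.
apply/cvgrPdist_le => e e0.
have e20 : 0 < e ^+ 2 by rewrite exprn_gt0.
have [N _ hN] := (cvgrPdist_le _ _).1 d0 _ e20; exists N => // n /hN /=.
rewrite sub0r normrN ger0_norm // => dn.
rewrite -(@ler_pXn2r _ 2) ?nnegrE ?(ltW e0) // distrC.
by apply: le_trans dn; exact: (nsq_le (fun j => X n j - u j)).
Qed.

End InertialErgodic.

(** * Estimates for the penalized primal-dual scheme *)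

(** Moves the summability assumptions from extended reals to real sequences; the bound [K] is
    uniform in the starting index [n1]. *)
Lemma nneseries_real {R : realType} (e : nat -> \bar R) :
  (forall n, (1 <= n)%N -> (0 <= e n)%E) -> (\sum_(1 <= n <oo) e n < +oo)%E ->
  exists h : nat -> R, (forall n, (1 <= n)%N -> e n = (h n)%:E) /\
    exists K : R, forall n n1, \sum_(k < n) h (k + n1).+1 <= K.
Proof.
move=> e0 efin.
have part n : (\sum_(1 <= k < n) e k <= \sum_(1 <= k <oo) e k)%E.
  by apply: nneseries_lim_ge => k k1 _; exact: e0.
have e_real n : (1 <= n)%N -> e n \is a fin_num.
  move=> n1; rewrite ge0_fin_numE ?e0 //; apply: le_lt_trans efin.
  apply: le_trans (part n.+1); rewrite big_nat_recr //= leeDr //.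
  by rewrite big_nat; apply: sume_ge0 => k /andP[k1 _]; exact: e0.
pose h n := fine (e n).
have eE n : (1 <= n)%N -> e n = (h n)%:E by move=> n1; rewrite fineK // e_real.
have h0 n : (1 <= n)%N -> 0 <= h n by move=> n1; rewrite fine_ge0 // e0.
exists h; split=> //; exists (fine (\sum_(1 <= k <oo) e k)%E) => n n1.
have S_real : (\sum_(1 <= k <oo) e k)%E \is a fin_num.
  rewrite ge0_fin_numE //; apply: nneseries_ge0 => k k1 _; exact: e0.
rewrite -lee_fin fineK //; apply: le_trans (part (n + n1).+1).
have -> : (\sum_(1 <= k < (n + n1).+1) e k = (\sum_(1 <= k < (n + n1).+1) h k)%:E)%E.
  by rewrite -sumEFin; apply: eq_big_nat => k /andP[k1 _]; exact: eE.
rewrite lee_fin (@big_cat_nat _ _ _ n1.+1 1 (n + n1).+1) //=; last by rewrite ltnS leq_addl.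
have -> : \sum_(n1.+1 <= k < (n + n1).+1) h k = \sum_(k < n) h (k + n1).+1.
  rewrite -{1}[n1.+1]add0n -addnS big_addn addnK big_mkord.
  by apply: eq_bigr => k _; rewrite addnS.
by rewrite lerDr; apply: sumr_nat_ge0 => k k1; exact: h0.
Qed.

Lemma not_in_ell1_unbounded {R : realType} (lam : nat -> R) :
  (forall n, (1 <= n)%N -> 0 < lam n) -> ~ in_ell 1 lam ->
  forall K : R, exists n, K <= \sum_(1 <= k < n.+1) lam k.
Proof.
move=> lam0 nell K; apply: contrapT => hK; apply: nell; rewrite /in_ell.
have {}hK n : \sum_(1 <= k < n.+1) lam k <= K.
  by rewrite leNgt; apply/negP => h; apply: hK; exists n; exact: ltW.
apply: (@le_lt_trans _ _ K%:E); last exact: ltry.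
apply: lime_le; first by apply: is_cvg_nneseries => n _ _; rewrite lee_fin.
apply: nearW => n; rewrite sumEFin lee_fin.
case: n => [|n]; first by rewrite big_geq // (le_trans _ (hK 0%N)) // big_geq.
apply: le_trans (hK n); rewrite le_eqVlt; apply/orP; left; apply/eqP.
by apply: eq_big_nat => k /andP[k1 _]; rewrite expr1 gtr0_norm // lam0.
Qed.

Lemma sum_option {R : nmodType} (m : nat) (F : option 'I_m -> R) :
  \sum_j F j = F None + \sum_(i < m) F (Some i).
Proof.
rewrite (bigD1 None) //=; congr (_ + _).
rewrite (reindex_omap Some id) /=; last by case.
by apply: eq_bigl => i; rewrite eqxx.
Qed.

(** Lagrange's identity: the double sum of [(l i * b j - l j * b i) ^+ 2] is twice the defect. *)
Lemma sum_cauchy_schwarz {R : rcfType} (m : nat) (l b : 'I_m -> R) :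
  (forall i, 0 <= l i) -> (forall i, 0 <= b i) ->
  \sum_i l i * b i <= Num.sqrt (\sum_i l i ^+ 2) * Num.sqrt (\sum_i b i ^+ 2).
Proof.
move=> l0 b0; rewrite -sqrtrM; last by apply: sumr_ge0 => i _; exact: sqr_ge0.
rewrite -[leLHS]ger0_norm; last by apply: sumr_ge0 => i _; exact: mulr_ge0.
rewrite -sqrtr_sqr ler_sqrt; last first.
  by apply: mulr_ge0; apply: sumr_ge0 => i _; exact: sqr_ge0.
have : 0 <= \sum_i \sum_j (l i * b j - l j * b i) ^+ 2.
  by apply: sumr_ge0 => i _; apply: sumr_ge0 => j _; exact: sqr_ge0.
have E : (\sum_i l i ^+ 2) * (\sum_i b i ^+ 2) = \sum_i \sum_j l i ^+ 2 * b j ^+ 2.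
  by rewrite mulr_suml; apply: eq_bigr => i _; rewrite mulr_sumr.
have E' : (\sum_i l i ^+ 2) * (\sum_i b i ^+ 2) = \sum_i \sum_j l j ^+ 2 * b i ^+ 2.
  by rewrite E exchange_big.
have -> : \sum_i \sum_j (l i * b j - l j * b i) ^+ 2 =
    2 * ((\sum_i l i ^+ 2) * (\sum_i b i ^+ 2)) - 2 * (\sum_i l i * b i) ^+ 2.
  rewrite mulr_natl mulr2n {1}E E'.
  rewrite expr2 mulr_suml mulr_sumr -big_split -sumrB; apply: eq_bigr => i _ /=.
  rewrite !mulr_sumr -big_split -sumrB; apply: eq_bigr => j _ /=; ring.
lra.
Qed.

(* The operator norm of [(x, v) |-> (C x + L^* v, D^-1 v - L x)] is at most
   [N + |L|], and the penalty term adds [c]. *)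
Lemma coupled_lipschitz {R : rcfType} (m : nat) (c lam N a r0 : R) (l b r : 'I_m -> R) :
  0 <= c -> 0 <= lam -> 0 <= N -> 0 <= a -> 0 <= r0 ->
  (forall i, 0 <= l i) -> (forall i, 0 <= b i) -> (forall i, 0 <= r i) ->
  r0 <= c * a + lam * (N * a) + lam * \sum_i l i * b i ->
  (forall i, r i <= lam * (l i * a) + lam * (N * b i)) ->
  r0 ^+ 2 + \sum_i r i ^+ 2 <=
  (c + lam * (N + Num.sqrt (\sum_i l i ^+ 2))) ^+ 2 * (a ^+ 2 + \sum_i b i ^+ 2).
Proof.
move=> c0 lam0 N0 a0 r00 l0 b0 ri0 hr0 hr.
have cs := sum_cauchy_schwarz l0 b0.
have S0 : 0 <= \sum_i l i * b i by apply: sumr_ge0 => i _; exact: mulr_ge0.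
set S := \sum_i l i * b i in cs S0 hr0.
have lsq : Num.sqrt (\sum_i l i ^+ 2) ^+ 2 = \sum_i l i ^+ 2.
  by rewrite sqr_sqrtr //; apply: sumr_ge0 => i _; exact: sqr_ge0.
have bsq : Num.sqrt (\sum_i b i ^+ 2) ^+ 2 = \sum_i b i ^+ 2.
  by rewrite sqr_sqrtr //; apply: sumr_ge0 => i _; exact: sqr_ge0.
have hsum : \sum_i r i ^+ 2 <=
    lam ^+ 2 * ((\sum_i l i ^+ 2) * a ^+ 2 + 2 * a * N * S + N ^+ 2 * \sum_i b i ^+ 2).
  apply: (@le_trans _ _ (\sum_i (lam * (l i * a) + lam * (N * b i)) ^+ 2)).
    apply: ler_sum => i _; rewrite ler_pXn2r ?nnegrE //.
    by apply: addr_ge0; apply: mulr_ge0 => //; exact: mulr_ge0.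
  rewrite /S mulr_suml !mulr_sumr -!big_split /= mulr_sumr.
  rewrite le_eqVlt; apply/orP; left; apply/eqP; apply: eq_bigr => i _; ring.
move: (sqrtr_ge0 (\sum_i l i ^+ 2)) (sqrtr_ge0 (\sum_i b i ^+ 2)) cs lsq bsq.
move: (Num.sqrt (\sum_i l i ^+ 2)) (Num.sqrt (\sum_i b i ^+ 2)) => el bb el0 bb0 cs lsq bsq.
rewrite -lsq -bsq in hsum *.
have {}hr0 : r0 ^+ 2 <= ((c + lam * N) * a + lam * (el * bb)) ^+ 2.
  rewrite ler_pXn2r ?nnegrE //.
    apply: le_trans hr0 _; have := ler_wpM2l lam0 cs; lra.
  by rewrite !addr_ge0 ?mulr_ge0 ?addr_ge0 ?mulr_ge0.
have {}hsum : \sum_i r i ^+ 2 <= lam ^+ 2 * (el * a + N * bb) ^+ 2.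
  apply: le_trans hsum _; rewrite ler_wpM2l ?sqr_ge0 //.
  have := ler_wpM2l (mulr_ge0 (mulr_ge0 (_ : 0 <= 2) a0) N0) cs; move=> /(_ _).
  lra.
apply: le_trans (lerD hr0 hsum) _.
(* The next three nonnegative terms add up exactly to the difference of the two sides. *)
have : 0 <= (lam * el * (c + 2 * lam * N)) * (a - bb) ^+ 2.
  by rewrite mulr_ge0 ?sqr_ge0 // !mulr_ge0 // addr_ge0 // !mulr_ge0.
have : 0 <= (lam * el * c) * a ^+ 2 by rewrite !mulr_ge0 // sqr_ge0.
have : 0 <= (c * c + 2 * c * lam * N + lam * el * c) * bb ^+ 2.
  by rewrite mulr_ge0 ?sqr_ge0 // !addr_ge0 // !mulr_ge0.
lra.
Qed.

Section Penalty.
Context {R : realType} {H : hilbertType R}.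
Variables (B : H -> H) (M : set H).

(** A normal vector [w] at [u] attains its support function at [u]. The supremum over [M] is bounded
    below by its value at [u], and the Fitzpatrick function there by its term at the graph point
    [(p, B p)]. *)
Lemma penalty_bound (lam beta : R) (u w p : H) :
  0 <= lam -> 0 < beta -> M u -> (forall y, M y -> inner w (y - u) <= 0) ->
  ((lam * (inner (p - u) (w - beta *: B p)))%:E <=
   (lam * beta)%:E * (ereal_sup [set fitzpatrick (op_fun B) y (beta^-1 *: w) | y in M]
      - support_fun M (beta^-1 *: w)))%E.
Proof.
move=> lam0 beta0 Mu hw.
have -> : support_fun M (beta^-1 *: w) = (inner u (beta^-1 *: w))%:E.
  apply/eqP; rewrite eq_le; apply/andP; split; last first.
    by apply: ereal_sup_ubound; exists u.
  apply: ub_ereal_sup => _ [y My <-]; rewrite lee_fin !innerZr ler_pM2l ?invr_gt0 //.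
  by have := hw y My; rewrite innerBr subr_le0 !(innerC w).
pose r := inner u (B p) + inner p (beta^-1 *: w) - inner p (B p) - inner u (beta^-1 *: w).
have -> : lam * inner (p - u) (w - beta *: B p) = lam * beta * r.
  by rewrite /r !innerE; field; rewrite gt_eqF.
rewrite EFinM; apply: lee_wpmul2l.
  by rewrite lee_fin mulr_ge0 // ltW.
rewrite /r EFinB leeB //.
apply: le_trans (_ : fitzpatrick (op_fun B) u (beta^-1 *: w) <= _)%E; last first.
  by apply: ereal_sup_ubound; exists u.
by apply: ereal_sup_ubound; exists (p, B p).
Qed.

(** At [p = u] the lower bound of [penalty_bound] is 0. *)
Lemma penalty_ge0 (lam beta : R) (u w : H) :
  0 <= lam -> 0 < beta -> M u -> B u = 0 -> (forall y, M y -> inner w (y - u) <= 0) ->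
  (0 <= (lam * beta)%:E * (ereal_sup [set fitzpatrick (op_fun B) y (beta^-1 *: w) | y in M]
      - support_fun M (beta^-1 *: w)))%E.
Proof.
move=> lam0 beta0 Mu Bu hw; apply: le_trans (penalty_bound u lam0 beta0 Mu hw).
by rewrite subrr inner0l mulr0.
Qed.

End Penalty.

(** * The primal-dual operator, its zeros and the algorithm step *)

Section PrimalDual.
Context {R : realType} {H : hilbertType R} {m : nat}.
Variable G : 'I_m -> hilbertType R.

(** The index [None] carries the primal variable and [Some i] the [i]-th dual variable. *)
Definition pd_space (j : option 'I_m) : hilbertType R := if j is Some i then G i else H.

Definition pd_pair (x : H) (v : forall i, G i) (j : option 'I_m) : pd_space j :=
  match j with Some i => v i | None => x end.

Variables (A N : H -> set H) (C : H -> H) (Bi : forall i, G i -> set (G i)).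
Variables (D : forall i, G i -> G i) (L : forall i, {linear H -> G i}).
Arguments D : clear implicits.
Arguments Bi : clear implicits.
Hypothesis Lc : forall i, continuous (L i).
Hypothesis Cm : forall x y, 0 <= inner (x - y) (C x - C y).
Hypothesis Dm : forall i x y, 0 <= inner (x - y) (D i x - D i y).

(** The graph of the Kuhn-Tucker operator. Here [D i] stands for the inverse of the operator [D_i]
    of the theorem, and the coupling through [L i] and its adjoint is skew. *)
Definition pd_graph (u w : forall j, pd_space j) : Prop :=
  (exists a c, [/\ A (u None) a, N (u None) c &
     w None = a + c + C (u None) + \sum_(i < m) adjoint (L i) (u (Some i))]) /\
  forall i, exists2 b, Bi i b (u (Some i)) &
     w (Some i) = b + D i (u (Some i)) - L i (u None).

Lemma inner_sum_adjoint z (v : forall i, G i) :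
  inner z (\sum_(i < m) adjoint (L i) (v i)) = \sum_(i < m) inner (v i) (L i z).
Proof.
by rewrite inner_sumr; apply: eq_bigr => i _; rewrite -adjointP // innerC.
Qed.

(** The correction step moves every single-valued term from [x] to [p]: with [ap] in [A p], the
    vector [y - x - al (x - x')] is [- lam] times the sum of [ap], [C p], [bet B p] and the adjoint
    images of the [q i]. Pairing with [p - u] uses the monotonicity of [A] and [C]. *)
Lemma primal_step (B : H -> H) (gam lam bet al : R) (x' x p y u a c w : H)
    (v q s : forall i, G i) :
  0 <= lam ->
  (forall x1 x2 u1 u2, A x1 u1 -> A x2 u2 ->
     gam * `|x1 - x2| ^+ 2 <= inner (x1 - x2) (u1 - u2)) ->
  resolvent (op_scale lam A)
    (x - lam *: (C x + \sum_(i < m) adjoint (L i) (v i)) - (lam * bet) *: B x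
     + al *: (x - x')) p ->
  y = (lam * bet) *: (B x - B p) + lam *: (C x - C p)
      + lam *: (\sum_(i < m) adjoint (L i) (v i - q i)) + p ->
  A u a -> w = a + c + C u + \sum_(i < m) adjoint (L i) (s i) ->
  inner (p - u) (y - x - al *: (x - x')) <=
    lam * inner (p - u) (c - bet *: B p) - lam * inner (p - u) w
    - lam * gam * `|p - u| ^+ 2 - lam * \sum_(i < m) inner (q i - s i) (L i (p - u)).
Proof.
move=> lam0 Am [_ -> [_ [ap Aap <-] hp]] hy Aua hw.
have h1 := ler_wpM2l lam0 (Am _ _ _ _ Aap Aua).
have h2 := ler_wpM2l lam0 (Cm p u).
move: (p - u) h1 h2 => z h1 h2.
have e1 := congr1 (inner z) hp; have e2 := congr1 (inner z) hy.
have eq : inner z (\sum_(i < m) adjoint (L i) (v i - q i)) =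
    \sum_(i < m) inner (v i) (L i z) - \sum_(i < m) inner (q i) (L i z).
  by rewrite inner_sum_adjoint -sumrB; apply: eq_bigr => i _; rewrite innerBl.
have eqs : \sum_(i < m) inner (q i - s i) (L i z) =
    \sum_(i < m) inner (q i) (L i z) - \sum_(i < m) inner (s i) (L i z).
  by rewrite -sumrB; apply: eq_bigr => i _; rewrite innerBl.
rewrite eqs hw.
move: e1 e2 h1 h2; rewrite !innerE eq (inner_sum_adjoint z v) (inner_sum_adjoint z s).
move: (inner z x) (inner z x') (inner z p) (inner z y) (inner z ap) (inner z a)
  (inner z (C p)) (inner z (C x)) (inner z (C u)) (inner z (B x)) (inner z (B p)) (inner z c).
move: (\sum_(i < m) inner (v i) (L i z)) (\sum_(i < m) inner (q i) (L i z))
  (\sum_(i < m) inner (s i) (L i z)) (`|z| ^+ 2).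
move=> *; lra.
Qed.

(** The same computation in a dual factor; the coupling term has the sign opposite to that in
    [primal_step]. *)
Lemma dual_step i (gam lam al : R) (v' v q y u b w : G i) (x p z : H) :
  0 <= lam ->
  (forall x1 x2 u1 u2, op_inv (Bi i) x1 u1 -> op_inv (Bi i) x2 u2 ->
     gam * `|x1 - x2| ^+ 2 <= inner (x1 - x2) (u1 - u2)) ->
  resolvent (op_scale lam (op_inv (Bi i)))
    (v + lam *: (L i x - D i v) + al *: (v - v')) q ->
  y = lam *: L i (p - x) + lam *: (D i v - D i q) + q ->
  Bi i b u -> w = b + D i u - L i z ->
  inner (q - u) (y - v - al *: (v - v')) <=
    - lam * inner (q - u) w - lam * gam * `|q - u| ^+ 2
    + lam * inner (q - u) (L i (p - z)).
Proof.
move=> lam0 Bm [_ -> [_ [bq Bbq <-] hq]] hy Bub ->.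
have h1 := ler_wpM2l lam0 (Bm _ _ _ _ Bbq Bub).
have h2 := ler_wpM2l lam0 (Dm q u).
move: (q - u) h1 h2 => r h1 h2.
have e1 := congr1 (inner r) hq; have e2 := congr1 (inner r) hy.
move: e1 e2 h1 h2; rewrite !linearB !innerE.
move: (inner r v) (inner r v') (inner r q) (inner r y) (inner r bq) (inner r b)
  (inner r (D i q)) (inner r (D i v)) (inner r (D i u)) (inner r (L i x)) (inner r (L i p))
  (inner r (L i z)) (`|r| ^+ 2).
move=> *; lra.
Qed.

End PrimalDual.

Section PrimalDualGraph.
Context {R : realType} {H : hilbertType R} {m : nat}.
Variable G : 'I_m -> hilbertType R.
Variables (A N : H -> set H) (C : H -> H) (Bi Di : forall i, G i -> set (G i)).
Variables (D : forall i, G i -> G i) (L : forall i, {linear H -> G i}).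
Arguments D : clear implicits.
Arguments Bi : clear implicits.
Arguments Di : clear implicits.
Hypothesis Lc : forall i, continuous (L i).

Local Notation W := (pd_graph A N C Bi D L).

Lemma op_inv_closed (E : hilbertType R) (T : E -> set E) :
  monotonically_closed T -> monotonically_closed (op_inv T).
Proof. by move=> Tc x u h; apply: Tc => y v Tyv; rewrite innerC; exact: h. Qed.

Lemma op_inv_monotone (E : hilbertType R) (T : E -> set E) :
  monotone_op T -> monotone_op (op_inv T).
Proof. by move=> Tm x y u v Tx Ty; rewrite innerC; exact: Tm. Qed.

(** Freezing the coupling at [z] decouples the inclusions, and [maximal_lipschitz_surj] solves each
    for a component of [u]. Tested at this graph point, the hypothesis says that minus a positive
    combination of the [|u j - z j|^2] is nonnegative, so [u = z]. *)
Lemma pd_graph_maximal (nu : R) (nui : 'I_m -> R) (z : forall j, pd_space G j) :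
  maximally_monotone (op_add A N) -> (forall i, maximally_monotone (Bi i)) ->
  0 <= nu -> (forall x y, `|C x - C y| <= nu * `|x - y|) ->
  (forall i, 0 <= nui i) -> (forall i x y, `|D i x - D i y| <= nui i * `|x - y|) ->
  (forall u w, W u w -> 0 <= dot (fun j => u j - z j) w) -> W z (fun=> 0).
Proof.
move=> ANm Bm nu0 Cl nui0 Dl hz.
have [k0 k00 /(_ (z None) (- \sum_(i < m) adjoint (L i) (z (Some i))))] :=
  maximal_lipschitz_surj (proj1 ANm) (maximally_monotone_closed ANm) nu0 Cl.
move=> [u0 [_ [[a Aa [c Nc <-]] h0]]].
have hi i : exists k us, [/\ 0 < k, Bi i us.2 us.1 &
    us.2 + D i us.1 - L i (z None) = k *: (z (Some i) - us.1)].
  have [k k1 /(_ (z (Some i)) (L i (z None)))[u [s [Ts hs]]]] := maximal_lipschitz_surj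
    (op_inv_monotone (proj1 (Bm i))) (op_inv_closed (maximally_monotone_closed (Bm i)))
    (nui0 i) (Dl i).
  by exists k, (u, s).
pose k i := projT1 (cid (hi i)).
pose u i := (projT1 (cid (projT2 (cid (hi i))))).1.
pose s i := (projT1 (cid (projT2 (cid (hi i))))).2.
have hk i : [/\ 0 < k i, Bi i (s i) (u i) &
    s i + D i (u i) - L i (z None) = k i *: (z (Some i) - u i)].
  exact: projT2 (cid (projT2 (cid (hi i)))).
pose U := pd_pair u0 u.
pose w : forall j, pd_space G j :=
  pd_pair (a + c + C u0 + \sum_(i < m) adjoint (L i) (u i))
    (fun i => s i + D i (u i) - L i u0).
have WU : W U w.
  split; first by exists a, c.
  by move=> i; exists (s i) => //; case: (hk i).
have := hz _ _ WU; rewrite /dot sum_option.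
have -> : inner (U None - z None) (w None) = - (k0 * `|U None - z None| ^+ 2)
    + \sum_(i < m) inner (U (Some i) - z (Some i)) (L i (U None - z None)).
  rewrite (_ : w None = - (k0 *: (U None - z None)) +
    \sum_(i < m) adjoint (L i) (U (Some i) - z (Some i))).
    by rewrite innerDr innerNr innerZr inner_sqr inner_sum_adjoint.
  rewrite -scalerN opprB -h0 opprK /=.
  have -> : \sum_(i < m) adjoint (L i) (u i - z (Some i)) =
      \sum_(i < m) adjoint (L i) (u i) - \sum_(i < m) adjoint (L i) (z (Some i)).
    by rewrite -sumrB; apply: eq_bigr => i _; exact: adjointB.
  by rewrite -[RHS]addrA; congr (_ + _); rewrite addrCA subrr addr0.
rewrite -addrA -big_split /=.
(* The coupling left over from the primal component cancels the dual one by skewness. *)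
have -> : \sum_(i < m) (inner (u i - z (Some i)) (L i (u0 - z None)) +
    inner (u i - z (Some i)) (s i + D i (u i) - L i u0)) =
    - \sum_(i < m) k i * `|u i - z (Some i)| ^+ 2.
  rewrite -sumrN; apply: eq_bigr => i _; have [_ _ e] := hk i.
  have e2 : L i (u0 - z None) + (s i + D i (u i) - L i u0) = k i *: (z (Some i) - u i).
    by rewrite linearB addrC addrA subrK.
  by rewrite -innerDr e2 -(opprB (u i)) scalerN innerNr innerZr inner_sqr.
rewrite -opprD oppr_ge0 => le0.
have p0 : 0 <= k0 * `|u0 - z None| ^+ 2 by rewrite mulr_ge0 ?sqr_ge0 // ltW.
have pi i : 0 <= k i * `|u i - z (Some i)| ^+ 2.
  by have [ki _ _] := hk i; rewrite mulr_ge0 ?sqr_ge0 // ltW.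
have ps : 0 <= \sum_(i < m) k i * `|u i - z (Some i)| ^+ 2 by apply: sumr_ge0 => i _.
have eq0 (E : hilbertType R) (x y : E) (r : R) : 0 < r -> r * `|x - y| ^+ 2 <= 0 -> x = y.
  move=> r0; rewrite pmulr_rle0 // => le; apply/eqP; rewrite -subr_eq0 -normr_eq0 -sqrf_eq0.
  by rewrite eq_le le sqr_ge0.
have u0z : u0 = z None by apply: (eq0 _ _ _ _ k00); apply: le_trans le0; rewrite lerDl.
have uz i : u i = z (Some i).
  have [ki _ _] := hk i; apply: (eq0 _ _ _ _ ki).
  apply: le_trans le0; apply: ler_wpDl => //.
  by rewrite (bigD1 i) //= lerDl; apply: sumr_ge0.
split.
  exists a, c; rewrite -u0z; split=> //.
  by move: h0; rewrite -u0z subrr scaler0 opprK => /esym.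
move=> i; have [_ Bs e] := hk i; rewrite -uz; exists (s i) => //.
by rewrite e -uz subrr scaler0.
Qed.

Hypothesis DiE : forall i, op_inv (Di i) = op_fun (D i).

(** The dual inclusions of a zero say that [z (Some i)] belongs to the parallel sum at [L i x]; such
    vectors are exactly the selections made in the primal inclusion. *)
Lemma zer_pd_graph x :
  zer (op_add (op_add (op_add A
         (op_sum (fun i => op_conj (L i) (parallel_sum (Bi i) (Di i)))))
         (op_fun C)) N) x <->
  exists2 z, W z (fun=> 0) & z None = x.
Proof.
have psE i y w : parallel_sum (Bi i) (Di i) y w <->
    exists2 b, Bi i b w & b + D i w = y.
  split.
    move=> [b Bb [d]]; rewrite DiE => -> <-; by exists b.
  by move=> [b Bb <-]; exists b => //; exists (D i w) => //; rewrite DiE.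
split.
  move=> [_ [_ [a Aa [_ [y hy <-] <-]] [_ -> <-]] [c Nc e]].
  have hv i : exists2 w, parallel_sum (Bi i) (Di i) (L i x) w & adjoint (L i) w = y i.
    exact: hy.
  pose v i := projT1 (cid2 (hv i)).
  have vE i : parallel_sum (Bi i) (Di i) (L i x) (v i) /\ adjoint (L i) (v i) = y i.
    by rewrite /v; case: (cid2 (hv i)).
  exists (pd_pair x v) => //; split.
    exists a, c; split => //=; apply: (eq_trans (esym e)).
    rewrite [in RHS](eq_bigr y); last by move=> i _; exact: (proj2 (vE i)).
        by rewrite [LHS]addrAC [a + _ + c]addrAC [LHS]addrAC.
  move=> i; have [/psE[b Bb bE] _] := vE i; exists b => //=.
  by rewrite bE subrr.
move=> [z [[a [c [Aa Nc e]]] hz] <-].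
exists (a + \sum_(i < m) adjoint (L i) (z (Some i)) + C (z None)).
  exists (a + \sum_(i < m) adjoint (L i) (z (Some i))); last by exists (C (z None)).
  exists a => //; exists (\sum_(i < m) adjoint (L i) (z (Some i))) => //.
  exists (fun i => adjoint (L i) (z (Some i))) => // i.
  exists (z (Some i)) => //; apply/psE.
  have [b Bb /esym/eqP bE] := hz i; exists b => //.
  by apply/eqP; rewrite -subr_eq0.
exists c => //; apply: (eq_trans _ (esym e)).
by rewrite [LHS]addrAC [a + _ + c]addrAC [LHS]addrAC.
Qed.

End PrimalDualGraph.

Section PrimalDualStep.
Context {R : realType} {H : hilbertType R} {m : nat}.
Variable G : 'I_m -> hilbertType R.
Variables (C B : H -> H) (D : forall i, G i -> G i) (L : forall i, {linear H -> G i}).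
Arguments D : clear implicits.
Variables (nu mu : R) (nui : 'I_m -> R).
Hypothesis Lc : forall i, continuous (L i).
Hypothesis nu0 : 0 <= nu.
Hypothesis mu0 : 0 < mu.
Hypothesis Cl : forall x y, `|C x - C y| <= nu * `|x - y|.
Hypothesis Dl : forall i x y, `|D i x - D i y| <= nui i * `|x - y|.
Hypothesis Bl : forall x y, `|B x - B y| <= mu^-1 * `|x - y|.

(** The vectors [p - y] and [q i - s i] consist only of differences of Lipschitz and linear terms,
    which [coupled_lipschitz] combines. *)
Lemma pd_step_lipschitz (lam bet : R) (x p y : H) (v q s : forall i, G i) :
  0 <= lam -> 0 <= bet ->
  y = (lam * bet) *: (B x - B p) + lam *: (C x - C p)
      + lam *: (\sum_(i < m) adjoint (L i) (v i - q i)) + p ->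
  (forall i, s i = lam *: L i (p - x) + lam *: (D i (v i) - D i (q i)) + q i) ->
  nsq (fun j => pd_pair p q j - pd_pair y s j) <=
  (lam * bet / mu + lam * (\big[Num.max/nu]_(i < m) nui i
     + Num.sqrt (\sum_(i < m) opnorm (L i) ^+ 2))) ^+ 2
  * nsq (fun j => pd_pair p q j - pd_pair x v j).
Proof.
move=> lam0 bet0 hy hs; rewrite /nsq !sum_option /=.
set N := \big[Num.max/nu]_(i < m) nui i.
have nuN : nu <= N by exact: bigmax_ge_id.
have nuiN i : nui i <= N by exact: le_bigmax.
have N0 : 0 <= N by exact: le_trans nuN.
apply: coupled_lipschitz => //.
- by rewrite !mulr_ge0 // invr_ge0 ltW.
- by move=> i; exact: opnorm_ge0.
- rewrite distrC hy addrK; apply: le_trans (ler_normD _ _) _; apply: lerD.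
    apply: le_trans (ler_normD _ _) _; apply: lerD.
      rewrite normrZ ger0_norm ?mulr_ge0 // -[leRHS]mulrA ler_wpM2l ?mulr_ge0 //.
      by rewrite (distrC p).
    rewrite normrZ ger0_norm // ler_wpM2l // (distrC p).
    by apply: le_trans (Cl _ _) _; rewrite ler_wpM2r.
  rewrite normrZ ger0_norm // ler_wpM2l //.
  apply: le_trans (ler_norm_sum _ _ _) _; apply: ler_sum => i _.
  by rewrite (distrC (q i)); exact: adjoint_le.
- move=> i; rewrite distrC hs addrK; apply: le_trans (ler_normD _ _) _; apply: lerD.
    by rewrite normrZ ger0_norm // ler_wpM2l // opnormP.
  rewrite normrZ ger0_norm // ler_wpM2l // (distrC (q i)).
  by apply: le_trans (Dl _ _) _; rewrite ler_wpM2r.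
Qed.

End PrimalDualStep.

(** Adding [primal_step] and all the [dual_step] cancels the coupling, so only the penalty term,
    bounded by [h n], remains. *)
Lemma pd_step_monotone {R : realType} {H : hilbertType R} {m : nat}
    (G : 'I_m -> hilbertType R) (A : H -> set H) (B C : H -> H)
    (Bi : forall i, G i -> set (G i)) (D : forall i, G i -> G i)
    (L : forall i, {linear H -> G i}) (gam : R) (lam bet al : nat -> R)
    (x p : nat -> H) (v q : forall i, nat -> G i) (h : nat -> R)
    (u w : forall j, pd_space G j) (a c : H) n :
  (forall i, continuous (L i)) ->
  (forall x y, 0 <= inner (x - y) (C x - C y)) ->
  (forall i x y, 0 <= inner (x - y) (D i x - D i y)) ->
  (forall x1 x2 u1 u2, A x1 u1 -> A x2 u2 ->
     gam * `|x1 - x2| ^+ 2 <= inner (x1 - x2) (u1 - u2)) ->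
  (forall i x1 x2 u1 u2, op_inv (Bi i) x1 u1 -> op_inv (Bi i) x2 u2 ->
     gam * `|x1 - x2| ^+ 2 <= inner (x1 - x2) (u1 - u2)) ->
  0 <= lam n ->
  resolvent (op_scale (lam n) A)
    (x n - lam n *: (C (x n) + \sum_(i < m) adjoint (L i) (v i n))
     - (lam n * bet n) *: B (x n) + al n *: (x n - x n.-1)) (p n) ->
  (forall i, resolvent (op_scale (lam n) (op_inv (Bi i)))
    (v i n + lam n *: (L i (x n) - D i (v i n)) + al n *: (v i n - v i n.-1)) (q i n)) ->
  x n.+1 = (lam n * bet n) *: (B (x n) - B (p n)) + lam n *: (C (x n) - C (p n))
      + lam n *: (\sum_(i < m) adjoint (L i) (v i n - q i n)) + p n ->
  (forall i, v i n.+1 = lam n *: L i (p n - x n)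
      + lam n *: (D i (v i n) - D i (q i n)) + q i n) ->
  A (u None) a ->
  w None = a + c + C (u None) + \sum_(i < m) adjoint (L i) (u (Some i)) ->
  (forall i, exists2 b, Bi i b (u (Some i)) &
     w (Some i) = b + D i (u (Some i)) - L i (u None)) ->
  lam n * inner (p n - u None) (c - bet n *: B (p n)) <= h n ->
  dot (fun j => pd_pair (p n) (fun i => q i n) j - u j)
      (fun j => pd_pair (x n.+1) (fun i => v i n.+1) j - pd_pair (x n) (fun i => v i n) j
         - al n *: (pd_pair (x n) (fun i => v i n) j - pd_pair (x n.-1) (fun i => v i n.-1) j))
  <= h n + lam n * dot (fun j => u j - pd_pair (p n) (fun i => q i n) j) w
     - lam n * gam * nsq (fun j => pd_pair (p n) (fun i => q i n) j - u j).
Proof.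
move=> Lc Cm Dm Am Bm lam0 hp hq hx hv Aua hw0 hw hn.
have hN := primal_step Lc Cm lam0 Am hp hx Aua hw0.
have hS i : inner (q i n - u (Some i)) (v i n.+1 - v i n - al n *: (v i n - v i n.-1)) <=
    - lam n * inner (q i n - u (Some i)) (w (Some i)) - lam n * gam * `|q i n - u (Some i)| ^+ 2
    + lam n * inner (q i n - u (Some i)) (L i (p n - u None)).
  have [b Bb wE] := hw i.
  exact: (dual_step Dm lam0 (Bm i) (hq i) (hv i) Bb wE).
rewrite /dot /nsq !sum_option /=.
have h1 := ler_sum (index_enum 'I_m) (P := xpredT) (fun i _ => hS i).
refine (le_trans (lerD hN h1) _).
rewrite !big_split /= sumrN -!mulr_sumr.
have -> : inner (u None - p n) (w None) = - inner (p n - u None) (w None).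
  by rewrite -innerNl opprB.
have -> : \sum_(i < m) inner (u (Some i) - q i n) (w (Some i)) =
    - \sum_(i < m) inner (q i n - u (Some i)) (w (Some i)).
  by rewrite -sumrN; apply: eq_bigr => i _; rewrite -innerNl opprB.
move: hn; set S1 := \sum_(i < m) _; set S2 := \sum_(i < m) _; set S3 := \sum_(i < m) _.
lra.
Qed.

Theorem theorem15 (R : realType) (H : hilbertType R)
    (A : H -> set H) (C : H -> H) (nu : R)
    (m : nat) (G : 'I_m -> hilbertType R)
    (Bi Di : forall i : 'I_m, G i -> set (G i))
    (Dinv : forall i : 'I_m, G i -> G i) (nui : 'I_m -> R)
    (L : forall i : 'I_m, {linear H -> G i})
    (B : H -> H) (mu : R)
    (lambda beta alpha : nat -> R)
    (x p : nat -> H) (v q : forall i : 'I_m, nat -> G i) :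
  let M : set H := zer (op_fun B) in
  let NM : H -> set H := normal_cone M in
  let Z : set H :=
    zer (op_add (op_add (op_add A
           (op_sum (fun i => op_conj (L i) (parallel_sum (Bi i) (Di i)))))
           (op_fun C)) NM) in
  let bet : R :=
    \big[Num.max/nu]_(i < m) nui i + Num.sqrt (\sum_(i < m) opnorm (L i) ^+ 2) in
  let z : nat -> H := ergodic_mean lambda x in
  maximally_monotone A ->
  monotone_op (op_fun C) -> 0 < nu -> nu.-lipschitz C ->
  (1 <= m)%N ->
  (forall i, maximally_monotone (Bi i)) ->
  (forall i, monotone_op (Di i)) ->
  (forall i, op_inv (Di i) = op_fun (Dinv i)) ->
  (forall i, 0 < nui i) -> (forall i, (nui i).-lipschitz (Dinv i)) ->
  (forall i, continuous (L i)) -> (forall i, exists y, L i y != 0) ->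
  monotone_op (op_fun B) -> 0 < mu -> (mu^-1).-lipschitz B ->
  M !=set0 ->
  (forall n, (1 <= n)%N -> 0 < lambda n) ->
  (forall n, (1 <= n)%N -> 0 < beta n) ->
  (forall n, (1 <= n)%N -> 0 < alpha n) ->
  (forall n, (1 <= n)%N ->
    resolvent (op_scale (lambda n) A)
      (x n - lambda n *: (C (x n) + \sum_(i < m) adjoint (L i) (v i n))
        - (lambda n * beta n) *: B (x n) + alpha n *: (x n - x n.-1))
      (p n)) ->
  (forall i n, (1 <= n)%N ->
    resolvent (op_scale (lambda n) (op_inv (Bi i)))
      (v i n + lambda n *: (L i (x n) - Dinv i (v i n))
        + alpha n *: (v i n - v i n.-1))
      (q i n)) ->
  (forall n, (1 <= n)%N ->
    x n.+1 = (lambda n * beta n) *: (B (x n) - B (p n))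
      + lambda n *: (C (x n) - C (p n))
      + lambda n *: (\sum_(i < m) adjoint (L i) (v i n - q i n)) + p n) ->
  (forall i n, (1 <= n)%N ->
    v i n.+1 = lambda n *: L i (p n - x n)
      + lambda n *: (Dinv i (v i n) - Dinv i (q i n)) + q i n) ->
  maximally_monotone (op_add A NM) -> Z !=set0 ->
  (forall w, ran NM w ->
    (\sum_(1 <= n <oo)
       (lambda n * beta n)%:E *
       (ereal_sup [set fitzpatrick (op_fun B) y ((beta n)^-1 *: w) | y in M]
        - support_fun M ((beta n)^-1 *: w)) < +oo)%E) ->
  in_ell 2 lambda -> ~ in_ell 1 lambda ->
  (forall n k, (1 <= n)%N -> (n <= k)%N -> alpha n <= alpha k) ->
  (exists n0 : nat, exists a s : R,
    [/\ (1 <= n0)%N, 0 <= a, 0 < s &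
      forall n, (n0 <= n)%N ->
        0 <= alpha n <= a /\
        5 * a + 2 * s + (1 + 4 * a + 2 * s)
          * (lambda n * beta n / mu + lambda n * bet) ^+ 2 <= 1]) ->
  (exists2 l, Z l & weak_cvg z l) /\
  (strongly_monotone A -> (forall i, strongly_monotone (op_inv (Bi i))) ->
   exists2 l, Z = [set l] & x n @[n --> \oo] --> l).
Proof.
move=> M NM Z bet z Amax Cm nu0 Clip m1 Bimax Dimon DiE nui0 Dlip Lc _ Bm mu0 Blip _
  lam0 beta0 alpha0 hp hq hx hv ANmax Zne sumfin lam2 lam1 alS [n0 [a [s [n0_gt0 a0 s0 hpar]]]].
have Cl y1 y2 : `|C y1 - C y2| <= nu * `|y1 - y2| by exact: (Clip (y1, y2) (conj I I)).
have Bl y1 y2 : `|B y1 - B y2| <= mu^-1 * `|y1 - y2| by exact: (Blip (y1, y2) (conj I I)).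
have Dl i y1 y2 : `|Dinv i y1 - Dinv i y2| <= nui i * `|y1 - y2|.
  exact: (Dlip i (y1, y2) (conj I I)).
have Cmon y1 y2 : 0 <= inner (y1 - y2) (C y1 - C y2) by exact: Cm.
have Dmon i y1 y2 : 0 <= inner (y1 - y2) (Dinv i y1 - Dinv i y2).
  have Dv y : Di i (Dinv i y) y by rewrite -[Di i _ y]/(op_inv (Di i) y _) DiE.
  by rewrite innerC; exact: Dimon.
(* Writing [n0] as [n1.+1] turns [n0 <= n] into the condition [n1 < n] of the abstract iteration. *)
case: n0 n0_gt0 hpar => // n1 _ hpar.
pose X n := pd_pair (x n) (fun i => v i n).
pose P n := pd_pair (p n) (fun i => q i n).
pose th n := lambda n * beta n / mu + lambda n * bet.
pose W := pd_graph A NM C Bi Dinv L.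
have alP n : (n1 < n)%N -> 0 <= alpha n <= a by move=> /hpar[].
have alS' n : (n1 < n)%N -> alpha n <= alpha n.+1.
  by move=> nn; apply: alS => //; exact: leq_trans nn.
have param n : (n1 < n)%N -> 5 * a + 2 * s + (1 + 4 * a + 2 * s) * th n ^+ 2 <= 1.
  by move=> /hpar[].
have ge1 n : (n1 < n)%N -> (1 <= n)%N by exact: leq_trans.
have step_lip n : (n1 < n)%N ->
    nsq (fun j => P n j - X n.+1 j) <= th n ^+ 2 * nsq (fun j => P n j - X n j).
  move=> /ge1 nn; have lam0n := ltW (lam0 _ nn); have bet0n := ltW (beta0 _ nn).
  exact: (pd_step_lipschitz Lc (ltW nu0) mu0 Cl Dl Bl lam0n bet0n (hx n nn) (fun i => hv i n nn)).
(* Kept general in [gam]: the ergodic statement takes [gam = 0], the strong one the least of the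
   strong monotonicity constants. *)
have step_mono gam :
    (forall x1 x2 u1 u2, A x1 u1 -> A x2 u2 ->
       gam * `|x1 - x2| ^+ 2 <= inner (x1 - x2) (u1 - u2)) ->
    (forall i x1 x2 u1 u2, op_inv (Bi i) x1 u1 -> op_inv (Bi i) x2 u2 ->
       gam * `|x1 - x2| ^+ 2 <= inner (x1 - x2) (u1 - u2)) ->
    forall u w, W u w -> exists h : nat -> R,
      [/\ forall n, (n1 < n)%N -> 0 <= h n,
      exists K : R, forall n, \sum_(k < n) h (k + n1).+1 <= K &
      forall n, (n1 < n)%N ->
      dot (fun j => P n j - u j)
          (fun j => X n.+1 j - X n j - alpha n *: (X n j - X n.-1 j))
      <= h n + lambda n * dot (fun j => u j - P n j) w
         - lambda n * gam * nsq (fun j => P n j - u j)].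
  move=> Am Bim u w [[b [c [Ab [Mu Nc] hw0]]] hw].
  have Bu : B (u None) = 0 by rewrite (_ : 0 = B (u None)).
  (* The normal component [c] of the graph point is the vector at which the summability assumption
     is used; its terms become the errors [h]. *)
  have ranc : ran NM c by exists (u None).
  have e0 n (nn : (1 <= n)%N) := penalty_ge0 (ltW (lam0 n nn)) (beta0 n nn) Mu Bu Nc.
  have [h [hE [K hK]]] := nneseries_real e0 (sumfin c ranc).
  exists h; split.
  - by move=> n /ge1 nn; rewrite -lee_fin -hE // e0.
  - by exists K => n; exact: hK.
  - move=> n /ge1 nn.
    have hn : lambda n * inner (p n - u None) (c - beta n *: B (p n)) <= h n.
      rewrite -lee_fin -hE //.
      exact: (penalty_bound B (p n) (ltW (lam0 n nn)) (beta0 n nn) Mu Nc).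
    exact: (@pd_step_monotone _ _ _ G A B C Bi Dinv L gam lambda beta alpha x p v q h
      u w b c n Lc Cmon Dmon Am Bim (ltW (lam0 n nn)) (hp n nn)
      (fun i => hq i n nn) (hx n nn) (fun i => hv i n nn) Ab hw0 hw hn).
have lam_sq : exists K : R, forall n, \sum_(k < n) lambda (k + n1).+1 ^+ 2 <= K.
  have [|h [hE [K hK]]] := nneseries_real _ lam2.
    by move=> n _; rewrite lee_fin exprn_ge0.
  exists K => n; apply: le_trans (hK n n1); apply: ler_sum => k _.
  have [] := hE (k + n1).+1 isT.
  by rewrite real_normK ?num_real // => ->.
have lam_inf := not_in_ell1_unbounded lam0 lam1.
have W_max y : (forall u w, W u w -> 0 <= dot (fun j => u j - y j) w) -> W y (fun=> 0).
  exact: (pd_graph_maximal Lc ANmax Bimax (ltW nu0) Cl (fun i => ltW (nui0 i)) Dl).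
have WZ y : Z y <-> exists2 l, W l (fun=> 0) & l None = y.
  exact: (zer_pd_graph A NM C Bi L DiE).
have W_zero : exists l, W l (fun=> 0).
  by case: Zne => y /WZ[l Wl _]; exists l.
split.
  have [|l Wl hl] := ergodic_weak_cvg (gam := 0) a0 s0 (lexx 0) lam0 alP alS' param step_lip
    _ lam_sq lam_inf W_max W_zero.
    apply: step_mono => [x1 x2 u1 u2 A1 A2|i x1 x2 u1 u2 B1 B2]; rewrite mul0r.
      exact: (proj1 Amax).
    exact: (op_inv_monotone (proj1 (Bimax i))).
  by exists (l None); [apply/WZ; exists l|exact: (hl None)].
move=> [cA cA0 Astr] Bstr.
have /choice[cB hcB] : forall i, exists c : R, 0 < c /\
    forall x1 x2 u1 u2, op_inv (Bi i) x1 u1 -> op_inv (Bi i) x2 u2 ->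
       c * `|x1 - x2| ^+ 2 <= inner (x1 - x2) (u1 - u2).
  by move=> i; have [c c0 hc] := Bstr i; exists c.
pose gam := \big[Num.min/cA]_(i < m) cB i.
have gam0 : 0 < gam by apply: lt_bigmin => // i _; case: (hcB i).
have hstrong l : W l (fun=> 0) -> x n @[n --> \oo] --> l None.
  move=> Wl.
  apply: (strong_cvg (gam := gam) a0 s0 (ltW gam0) lam0 alP alS' param step_lip
    _ lam_sq lam_inf W_zero gam0 Wl (j := None)).
  apply: step_mono => [x1 x2 u1 u2 A1 A2|i x1 x2 u1 u2 B1 B2].
    apply: le_trans (Astr _ _ _ _ A1 A2); rewrite ler_wpM2r ?sqr_ge0 //.
    exact: bigmin_le_id.
  apply: le_trans (proj2 (hcB i) _ _ _ _ B1 B2); rewrite ler_wpM2r ?sqr_ge0 //.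
  exact: (bigmin_inf i).
(* The sequence [x] converges to the primal part of every zero, so uniqueness of limits makes [Z] a
   singleton. *)
have [l Wl] := W_zero; exists (l None); last exact: hstrong.
apply/seteqP; split => y /=; last by move=> ->; apply/WZ; exists l.
move=> /WZ[l' Wl' <-].
exact: (cvg_unique (@norm_hausdorff _ H) (hstrong _ Wl') (hstrong _ Wl)).
Qed.
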